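(* Let $M\models\mathsf{ZF}$ and $S\in M$ be such that $M\models\mathsf{SVC}(S)$. Then (with everything computed in $M$) there is a set $C$ of regular cardinals less than $\aleph^\ast(S)$ and a cardinal $\Omega$ such that: (1) for all $X$, if $\aleph(X)<\aleph^\ast(X)$ then $\operatorname{cf}(\aleph(X))\in C$; (2) for all $X$, if $\aleph(X)^+<\aleph^\ast(X)$ then $\aleph^\ast(X)\leq\aleph^\ast(S)$; and (3) for all cardinals $\lambda\geq\Omega$, if $\operatorname{cf}(\lambda)\in C$ then there is $X$ such that $\aleph(X)=\lambda$ and $\aleph^\ast(X)=\lambda^+$.
   Context: ''Cardinal'' means an initial ordinal; $\lambda^+$ is the least cardinal greater than $\lambda$. $|X|\leq|Y|$ means there is an injection $X\to Y$; $|X|\leq^\ast|Y|$ means there is a surjection $Y\to X$ or $X=\emptyset$. The Hartogs number $\aleph(X)$ is the least ordinal $\alpha$ such that $|\alpha|\nleq|X|$; the Lindenbaum number $\aleph^\ast(X)$ is the least ordinal $\alpha$ such that $|\alpha|\nleq^\ast|X|$. Both are cardinals. $\mathsf{SVC}(S)$ is the statement: for every set $X$ there is an ordinal $\eta$ such that $|X|\leq^\ast|S\times\eta|$. *)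

(* Defs.v *)
(* Stdlib only.  Models of ZF are arbitrary (possibly ill-founded) structures
   for the first-order language of set theory; every notion below is computed
   inside such a structure, all quantifiers ranging over its elements. *)

Set Implicit Arguments.

Record set_structure : Type := SetStructure {
  univ :> Type;
  mem : univ -> univ -> Prop
}.

Declare Scope set_scope.
Notation "x ∈ y" := (mem _ x y) (at level 70, no associativity) : set_scope.
Open Scope set_scope.

(* ---------- First-order formulas, needed for the two axiom schemes ----------
   Variables are de Bruijn indices: in [f_all p] and [f_ex p] the bound
   variable is variable 0 of [p], and variable [S n] of [p] is variable [n]
   outside. *)

Inductive formula : Type :=
| f_mem (i j : nat)
| f_eq (i j : nat)
| f_false
| f_not (p : formula)
| f_and (p q : formula)
| f_or (p q : formula)
| f_imp (p q : formula)
| f_all (p : formula)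
| f_ex (p : formula).

Definition scons {A : Type} (x : A) (e : nat -> A) : nat -> A :=
  fun n => match n with O => x | S m => e m end.

Fixpoint sat {M : set_structure} (e : nat -> M) (p : formula) : Prop :=
  match p with
  | f_mem i j => e i ∈ e j
  | f_eq i j => e i = e j
  | f_false => False
  | f_not p => ~ sat e p
  | f_and p q => sat e p /\ sat e q
  | f_or p q => sat e p \/ sat e q
  | f_imp p q => sat e p -> sat e q
  | f_all p => forall x : M, sat (scons x e) p
  | f_ex p => exists x : M, sat (scons x e) p
  end.

Definition subset {M : set_structure} (x y : M) : Prop :=
  forall z : M, z ∈ x -> z ∈ y.

Definition is_empty {M : set_structure} (x : M) : Prop :=
  forall z : M, ~ z ∈ x.

(* [p = {a, b}] *)
Definition is_upair {M : set_structure} (a b p : M) : Prop :=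
  forall z : M, z ∈ p <-> z = a \/ z = b.

(* [s = x ∪ {x}] *)
Definition is_succ {M : set_structure} (x s : M) : Prop :=
  forall z : M, z ∈ s <-> z ∈ x \/ z = x.

(* In both schemes the environment [e] supplies the parameters. *)
Record ZF (M : set_structure) : Prop := {
  zf_extensionality :
    forall x y : M, (forall z : M, z ∈ x <-> z ∈ y) -> x = y;
  zf_foundation :
    forall x : M, (exists y : M, y ∈ x) ->
      exists y : M, y ∈ x /\ forall z : M, z ∈ x -> ~ z ∈ y;
  zf_pairing :
    forall a b : M, exists p : M, is_upair a b p;
  zf_union :
    forall a : M, exists u : M,
      forall z : M, z ∈ u <-> exists y : M, y ∈ a /\ z ∈ y;
  zf_powerset :
    forall a : M, exists p : M, forall z : M, z ∈ p <-> subset z a;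
  zf_infinity :
    exists a : M,
      (exists x : M, is_empty x /\ x ∈ a) /\
      (forall x : M, x ∈ a -> exists s : M, is_succ x s /\ s ∈ a);
  zf_separation :
    forall (p : formula) (e : nat -> M) (a : M), exists b : M,
      forall x : M, x ∈ b <-> x ∈ a /\ sat (scons x e) p;
  zf_replacement :
    forall (p : formula) (e : nat -> M) (a : M),
      (forall x : M, x ∈ a -> exists! y : M, sat (scons y (scons x e)) p) ->
      exists b : M,
        forall y : M, y ∈ b <->
          exists x : M, x ∈ a /\ sat (scons y (scons x e)) p
}.

(* [p = (a, b) = {{a}, {a, b}}] *)
Definition is_opair {M : set_structure} (a b p : M) : Prop :=
  forall z : M, z ∈ p <-> is_upair a a z \/ is_upair a b z.

(* [P = X × Y] *)
Definition is_product {M : set_structure} (X Y P : M) : Prop :=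
  forall p : M, p ∈ P <->
    exists x y : M, x ∈ X /\ y ∈ Y /\ is_opair x y p.

(* [(x, y) ∈ f] *)
Definition maps {M : set_structure} (f x y : M) : Prop :=
  exists p : M, is_opair x y p /\ p ∈ f.

Definition is_function {M : set_structure} (f X Y : M) : Prop :=
  (forall p : M, p ∈ f ->
     exists x y : M, x ∈ X /\ y ∈ Y /\ is_opair x y p) /\
  (forall x : M, x ∈ X -> exists! y : M, maps f x y).

Definition is_injection {M : set_structure} (f X Y : M) : Prop :=
  is_function f X Y /\
  forall x x' y : M, maps f x y -> maps f x' y -> x = x'.

Definition is_surjection {M : set_structure} (f X Y : M) : Prop :=
  is_function f X Y /\
  forall y : M, y ∈ Y -> exists x : M, maps f x y.

(* |X| ≤ |Y| *)
Definition card_le {M : set_structure} (X Y : M) : Prop :=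
  exists f : M, is_injection f X Y.

(* |X| ≤* |Y| *)
Definition card_le_star {M : set_structure} (X Y : M) : Prop :=
  (exists f : M, is_surjection f Y X) \/ is_empty X.

(* |X| = |Y| *)
Definition equipotent {M : set_structure} (X Y : M) : Prop :=
  exists f : M, is_injection f X Y /\ is_surjection f X Y.

(* A transitive set strictly well-ordered by ∈. *)
Definition ordinal {M : set_structure} (a : M) : Prop :=
  (forall x : M, x ∈ a -> subset x a) /\
  (forall x : M, x ∈ a -> ~ x ∈ x) /\
  (forall x y z : M, x ∈ a -> y ∈ a -> z ∈ a -> x ∈ y -> y ∈ z -> x ∈ z) /\
  (forall x y : M, x ∈ a -> y ∈ a -> x ∈ y \/ x = y \/ y ∈ x) /\
  (forall b : M, subset b a -> (exists x : M, x ∈ b) ->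
     exists x : M, x ∈ b /\ forall y : M, y ∈ b -> x = y \/ x ∈ y).

(* The order of the ordinals; its strict part is [mem]. *)
Definition ord_le {M : set_structure} (a b : M) : Prop := a ∈ b \/ a = b.

(* The operations ℵ, ℵ*, cf, (-)⁺ are given by their graphs. *)
Definition is_least_ordinal {M : set_structure} (P : M -> Prop) (a : M) : Prop :=
  ordinal a /\ P a /\ forall b : M, ordinal b -> P b -> ord_le a b.

Definition cardinal {M : set_structure} (k : M) : Prop :=
  ordinal k /\ forall b : M, b ∈ k -> ~ equipotent b k.

(* [s = k⁺] *)
Definition is_succ_cardinal {M : set_structure} (k s : M) : Prop :=
  is_least_ordinal (fun b => cardinal b /\ k ∈ b) s.

(* [h = ℵ(X)] *)
Definition is_hartogs {M : set_structure} (X h : M) : Prop :=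
  is_least_ordinal (fun b => ~ card_le b X) h.

(* [l = ℵ*(X)] *)
Definition is_lindenbaum {M : set_structure} (X l : M) : Prop :=
  is_least_ordinal (fun b => ~ card_le_star b X) l.

Definition is_cofinal_map {M : set_structure} (f b a : M) : Prop :=
  is_function f b a /\
  forall x : M, x ∈ a -> exists d y : M, maps f d y /\ ord_le x y.

(* [c = cf(a)] *)
Definition is_cofinality {M : set_structure} (a c : M) : Prop :=
  is_least_ordinal (fun b => exists f : M, is_cofinal_map f b a) c.

Definition limit_ordinal {M : set_structure} (a : M) : Prop :=
  ordinal a /\ (exists x : M, x ∈ a) /\
  forall x : M, x ∈ a -> exists y : M, y ∈ a /\ x ∈ y.

Definition is_omega {M : set_structure} (w : M) : Prop :=
  is_least_ordinal limit_ordinal w.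

(* Regular cardinals are infinite by convention. *)
Definition regular_cardinal {M : set_structure} (k : M) : Prop :=
  cardinal k /\ (exists w : M, is_omega w /\ ord_le w k) /\ is_cofinality k k.

(* Small Violations of Choice, with seed S. *)

Definition SVC {M : set_structure} (S : M) : Prop :=
  forall X : M, exists eta P : M,
    ordinal eta /\ is_product S eta P /\ card_le_star X P.

(* Main.v *)
Require Import Defs.
From Stdlib Require Import Classical ClassicalEpsilon FunctionalExtensionality.

(** Everything rests on one property of a limit ordinal [k]: there is a set [Z], related
    to [k], that reaches arbitrarily high in [k] although no well-orderable subset of it
    does ([thinly_cofinal]). The property passes from [k] to its cofinality
    ([thinly_cofinal_cofinality]). The set [C] consists of the regular cardinals below
    the Lindenbaum number of [S] that have the property, and [Omega] is a cardinal above
    the Lindenbaum numbers of suitable witnesses [Z], one for each member of [C].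

    Let [h] be the Hartogs number of [X] and suppose that [X] maps onto [h]. Then [h] has
    the property ([thinly_cofinal_of_gap]). If [h] is regular, [X] is a witness: its
    well-orderable subsets are smaller than [h], so a map to [h] is bounded on them. If
    [h] is singular, the injections of ordinals below [h] into [X] are a witness: a
    well-ordered family of them with unbounded domains would cover [h] by fewer than [h]
    pieces whose sizes are bounded below [h], against Hessenberg's theorem. By the choice of the
    seed, a witness [Z] for [c], the cofinality of [h], is a union of well-orderable
    sets indexed by [S]; each of them is bounded in [c], and the bounds map [S] onto an
    unbounded subset of [c], so [c] is below the Lindenbaum number of [S]
    ([thinly_cofinal_seed]).

    Conversely, a witness for the cofinality of [lambda], spread over [lambda] along a
    cofinal map, has Hartogs number [lambda] and Lindenbaum number the successor of
    [lambda] as soon as [lambda] is at least the Lindenbaum number of the witness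
    ([gap_of_thinly_cofinal]).

    For the second clause, if [X] maps onto a cardinal [t] above its Hartogs number [h],
    the seed covers [t] by sets of order type below [h], indexed by [S]. So [S] times [h]
    maps onto [t], and then [S] alone does ([card_le_star_absorb]). The last step is
    immediate for regular [t] but [t] may well be singular, even as a successor
    cardinal. Suppose that [S] does not map onto [t]. Call a part of [S] small if at each
    index it takes a set of values whose order type stays below a bound that is itself
    below [t] and serves all indices. A well-ordered union of small parts is small
    ([small_union]), because otherwise one could choose the index according to the part
    and read off a map from [S] onto a set of order type [t]. For the same reason, at
    each index only few values are taken on a part of [S] that is not small
    ([big_uniform]). The elements of [S] that somewhere take another value form a union
    of small parts, and the remaining ones have few values, so [S] would be small and
    could not cover [t].

    A model satisfies separation and replacement for formulas only. Each use of them is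
    reduced to a closure property of definable predicates and terms ([Dfn], [Trm]),
    which the tactic [dfn] establishes. Order types are obtained without recursion, by
    minimizing over increasing maps ([rank]). *)

Set Implicit Arguments.

(** Lets the set operations below find the axioms by instance resolution. *)
Existing Class ZF.

(** * Definability with parameters *)

Section Definability.
Context {M : set_structure} {hM : ZF M}.
Notation env := (nat -> M).

Fixpoint rename (r : nat -> nat) (p : formula) : formula :=
  match p with
  | f_mem i j => f_mem (r i) (r j)
  | f_eq i j => f_eq (r i) (r j)
  | f_false => f_false
  | f_not p => f_not (rename r p)
  | f_and p q => f_and (rename r p) (rename r q)
  | f_or p q => f_or (rename r p) (rename r q)
  | f_imp p q => f_imp (rename r p) (rename r q)
  | f_all p => f_all (rename (scons 0 (fun n => S (r n))) p)
  | f_ex p => f_ex (rename (scons 0 (fun n => S (r n))) p)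
  end.

Lemma sat_rename (p : formula) : forall (r : nat -> nat) (e e' : env),
  (forall n, e' n = e (r n)) -> (sat e' p <-> sat e (rename r p)).
Proof.
  assert (up : forall (r : nat -> nat) (e e' : env) (x : M),
    (forall n, e' n = e (r n)) ->
    forall n, scons x e' n = scons x e (scons 0 (fun n => S (r n)) n)).
  { intros r e e' x H [|n]; simpl; auto. }
  induction p; simpl; intros r e e' H.
  - rewrite !H; tauto.
  - rewrite !H; tauto.
  - tauto.
  - rewrite IHp by eauto; tauto.
  - rewrite IHp1, IHp2 by eauto; tauto.
  - rewrite IHp1, IHp2 by eauto; tauto.
  - rewrite IHp1, IHp2 by eauto; tauto.
  - split; intros K x; specialize (K x); revert K; apply IHp; auto.
  - split; intros [x K]; exists x; revert K; apply IHp; auto.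
Qed.

(** Formulas are read in environments that hold the variables at the even places and
    the parameters at the odd ones, so that either list can grow without disturbing
    the other. *)
Fixpoint mix {A : Type} (f g : nat -> A) (n : nat) : A :=
  match n with
  | 0 => f 0
  | 1 => g 0
  | S (S n) => mix (fun k => f (S k)) (fun k => g (S k)) n
  end.

Fixpoint ev (n : nat) : nat := match n with 0 => 0 | S n => S (S (ev n)) end.
Definition od (n : nat) : nat := S (ev n).

Lemma mix_ev {A} (n : nat) : forall f g : nat -> A, mix f g (ev n) = f n.
Proof. induction n; simpl; auto. Qed.

Lemma mix_od {A} (n : nat) : forall f g : nat -> A, mix f g (od n) = g n.
Proof.
  unfold od; induction n; intros f g; [reflexivity|].
  exact (IHn (fun k => f (S k)) (fun k => g (S k))).
Qed.

Lemma mix_rename {A} (f g : nat -> A) (h : nat -> A) (r s : nat -> nat) :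
  (forall n, f n = h (r n)) -> (forall n, g n = h (s n)) ->
  forall n, mix f g n = h (mix r s n).
Proof.
  intros Hf Hg n.
  enough (H : forall n (f g : nat -> A) r s, (forall n, f n = h (r n)) ->
    (forall n, g n = h (s n)) ->
    mix f g n = h (mix r s n) /\ mix f g (S n) = h (mix r s (S n)))
    by (apply H; auto).
  clear; induction n; intros f g r s Hf Hg; [simpl; auto|].
  split; [apply IHn; auto|].
  apply (IHn (fun k => f (S k)) (fun k => g (S k)) (fun k => r (S k)) (fun k => s (S k))); auto.
Qed.

(** First-order definability with parameters, as a property of predicates of the
    ambient logic. Its closure properties make the two axiom schemes usable without
    writing formulas. *)
Definition Dfn (P : env -> Prop) : Prop :=
  exists (p : formula) (c : env), forall e, P e <-> sat (mix e c) p.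

(** A term is definable when its graph is; the value sits in slot 0. *)
Definition Trm (t : env -> M) : Prop := Dfn (fun e => e 0 = t (fun n => e (S n))).

Lemma Dfn_ext (P Q : env -> Prop) : (forall e, P e <-> Q e) -> Dfn P -> Dfn Q.
Proof.
  intros H (p & c & K); exists p, c; intros e; rewrite <- H; auto.
Qed.

Lemma ZF_inhabited : inhabited M.
Proof. destruct (zf_infinity hM) as [a _]; exact (inhabits a). Qed.

Lemma Dfn_const (Q : Prop) : Dfn (fun _ => Q).
Proof.
  destruct ZF_inhabited as [m]; destruct (classic Q) as [H|H].
  - exists (f_not f_false), (fun _ => m); simpl; tauto.
  - exists f_false, (fun _ => m); simpl; tauto.
Qed.

Lemma Dfn_rename (P : env -> Prop) (r : nat -> nat) :
  Dfn P -> Dfn (fun e => P (fun n => e (r n))).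
Proof.
  intros (p & c & H); exists (rename (mix (fun n => ev (r n)) od) p), c.
  intros e; rewrite H; apply sat_rename, mix_rename.
  - intros n; rewrite mix_ev; auto.
  - intros n; rewrite mix_od; auto.
Qed.

Lemma Dfn_mem_var (i j : nat) : Dfn (fun e => e i ∈ e j).
Proof.
  destruct ZF_inhabited as [m].
  exists (f_mem (ev i) (ev j)), (fun _ => m); intros e; simpl.
  rewrite !mix_ev; tauto.
Qed.

Lemma Dfn_eq_var (i j : nat) : Dfn (fun e => e i = e j).
Proof.
  destruct ZF_inhabited as [m].
  exists (f_eq (ev i) (ev j)), (fun _ => m); intros e; simpl.
  rewrite !mix_ev; tauto.
Qed.

Lemma Trm_var (i : nat) : Trm (fun e => e i).
Proof. apply (Dfn_eq_var 0 (S i)). Qed.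

Lemma Trm_const (x : M) : Trm (fun _ => x).
Proof.
  exists (f_eq (ev 0) (od 0)), (fun _ => x); intros e; simpl; tauto.
Qed.

Lemma Dfn_not (P : env -> Prop) : Dfn P -> Dfn (fun e => ~ P e).
Proof.
  intros (p & c & H); exists (f_not p), c; intros e; simpl; rewrite H; tauto.
Qed.

(** Two formulas bring two lists of parameters, which are interleaved. *)
Lemma Dfn_binary (P Q : env -> Prop) (o : Prop -> Prop -> Prop)
    (fo : formula -> formula -> formula) :
  (forall (e : env) p q, sat e (fo p q) <-> o (sat e p) (sat e q)) ->
  (forall A A' B B', (A <-> A') -> (B <-> B') -> (o A B <-> o A' B')) ->
  Dfn P -> Dfn Q -> Dfn (fun e => o (P e) (Q e)).
Proof.
  intros Ho Hc (p & c & Hp) (q & d & Hq).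
  exists (fo (rename (mix ev (fun n => od (ev n))) p)
             (rename (mix ev (fun n => od (od n))) q)), (mix c d).
  intros e; rewrite Ho; apply Hc; [rewrite Hp|rewrite Hq];
    apply sat_rename, mix_rename; intros n; rewrite ?mix_ev, ?mix_od; auto;
    rewrite ?mix_ev, ?mix_od; auto.
Qed.

Lemma Dfn_and (P Q : env -> Prop) : Dfn P -> Dfn Q -> Dfn (fun e => P e /\ Q e).
Proof. apply Dfn_binary with (fo := f_and); simpl; tauto. Qed.

Lemma Dfn_or (P Q : env -> Prop) : Dfn P -> Dfn Q -> Dfn (fun e => P e \/ Q e).
Proof. apply Dfn_binary with (fo := f_or); simpl; tauto. Qed.

Lemma Dfn_imp (P Q : env -> Prop) : Dfn P -> Dfn Q -> Dfn (fun e => P e -> Q e).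
Proof. apply Dfn_binary with (o := fun A B => A -> B) (fo := f_imp); simpl; tauto. Qed.

Lemma Dfn_iff (P Q : env -> Prop) : Dfn P -> Dfn Q -> Dfn (fun e => P e <-> Q e).
Proof. intros; apply Dfn_and; apply Dfn_imp; auto. Qed.

(** Pushing a bound variable onto the environment moves the slots of the
    variables by two and leaves those of the parameters in place. *)
Lemma sat_scons_mix (p : formula) (c : env) :
  exists q, forall (e : env) (x : M),
    sat (mix (scons x e) c) p <-> sat (scons x (mix e c)) q.
Proof.
  exists (rename (mix (scons 0 (fun n => S (ev n))) (fun n => S (od n))) p).
  intros e x; apply sat_rename, mix_rename.
  - intros [|n]; simpl; auto. rewrite mix_ev; auto.
  - intros n; simpl (mix _ _ (od _)); change (c n = mix e c (od n)); rewrite mix_od; auto.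
Qed.

Lemma Dfn_ex (Q : M -> env -> Prop) :
  Dfn (fun e => Q (e 0) (fun n => e (S n))) -> Dfn (fun e => exists x, Q x e).
Proof.
  intros (p & c & H); destruct (sat_scons_mix p c) as [q Hq].
  exists (f_ex q), c; intros e; simpl.
  split; intros [x Hx]; exists x; [apply Hq, (H (scons x e)), Hx|].
  apply (H (scons x e)), Hq, Hx.
Qed.

Lemma Dfn_all (Q : M -> env -> Prop) :
  Dfn (fun e => Q (e 0) (fun n => e (S n))) -> Dfn (fun e => forall x, Q x e).
Proof.
  intros (p & c & H); destruct (sat_scons_mix p c) as [q Hq].
  exists (f_all q), c; intros e; simpl.
  split; intros Hx x; [apply Hq, (H (scons x e)), Hx|].
  apply (H (scons x e)), Hq, Hx.
Qed.

Lemma Dfn_subst (P : env -> Prop) (t : env -> M) :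
  Dfn P -> Trm t -> Dfn (fun e => P (scons (t e) e)).
Proof.
  intros HP Ht.
  apply Dfn_ext with (fun e => exists x, x = t e /\ P (scons x e)).
  { intros e; split; [intros (x & -> & H); auto|intros H; eauto]. }
  apply (Dfn_ex (fun x e => x = t e /\ P (scons x e))); apply Dfn_and; auto.
  revert HP; apply Dfn_ext; intros e.
  replace (scons (e 0) (fun n => e (S n))) with e; [tauto|].
  apply functional_extensionality; intros [|n]; auto.
Qed.

Lemma Trm_weaken (t : env -> M) : Trm t -> Trm (fun e => t (fun n => e (S n))).
Proof.
  intros H; apply (Dfn_rename (fun n => match n with 0 => 0 | S n => S (S n) end) H).
Qed.

Lemma Dfn_comp1 (R : M -> Prop) (t : env -> M) :
  Dfn (fun e => R (e 0)) -> Trm t -> Dfn (fun e => R (t e)).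
Proof. intros H Ht; apply (Dfn_subst H Ht). Qed.

Lemma Dfn_comp2 (R : M -> M -> Prop) (t u : env -> M) :
  Dfn (fun e => R (e 0) (e 1)) -> Trm t -> Trm u -> Dfn (fun e => R (t e) (u e)).
Proof.
  intros H Ht Hu.
  assert (H' := Dfn_rename (fun n => match n with 0 => 1 | 1 => 0 | n => n end) H).
  apply (Dfn_subst (P := fun e => R (e 0) (u (fun n => e (S n))))); auto.
  apply (Dfn_subst (P := fun e => R (e 1) (e 0))); auto using Trm_weaken.
Qed.

Lemma Dfn_comp3 (R : M -> M -> M -> Prop) (t u v : env -> M) :
  Dfn (fun e => R (e 0) (e 1) (e 2)) -> Trm t -> Trm u -> Trm v ->
  Dfn (fun e => R (t e) (u e) (v e)).
Proof.
  intros H Ht Hu Hv.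
  assert (H' := Dfn_rename
    (fun n => match n with 0 => 2 | 1 => 1 | 2 => 0 | n => n end) H).
  apply (Dfn_subst (P := fun e =>
    R (e 0) (u (fun n => e (S n))) (v (fun n => e (S n))))); [|exact Ht].
  apply (Dfn_subst (P := fun e => R (e 1) (e 0) (v (fun n => e (S (S n))))));
    [|exact (Trm_weaken Hu)].
  apply (Dfn_subst (P := fun e => R (e 2) (e 1) (e 0)));
    [exact H'|exact (Trm_weaken (Trm_weaken Hv))].
Qed.

Lemma Dfn_mem (t u : env -> M) : Trm t -> Trm u -> Dfn (fun e => t e ∈ u e).
Proof. apply Dfn_comp2, (Dfn_mem_var 0 1). Qed.

Lemma Dfn_eq (t u : env -> M) : Trm t -> Trm u -> Dfn (fun e => t e = u e).
Proof. apply Dfn_comp2, (Dfn_eq_var 0 1). Qed.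

Definition Rel1 (R : M -> Prop) : Prop := Dfn (fun e => R (e 0)).
Definition Rel2 (R : M -> M -> Prop) : Prop := Dfn (fun e => R (e 0) (e 1)).
Definition Rel3 (R : M -> M -> M -> Prop) : Prop :=
  Dfn (fun e => R (e 0) (e 1) (e 2)).
Definition Fn (F : M -> M) : Prop := Trm (fun e => F (e 0)).
Definition Fn2 (F : M -> M -> M) : Prop := Trm (fun e => F (e 0) (e 1)).

Lemma Trm_comp1 (F : M -> M) (t : env -> M) :
  Fn F -> Trm t -> Trm (fun e => F (t e)).
Proof.
  intros H Ht; unfold Fn, Trm in *.
  apply (Dfn_comp2 (fun y x => y = F x)); auto.
  - apply Trm_var.
  - exact (Trm_weaken Ht).
Qed.

Lemma Trm_comp2 (F : M -> M -> M) (t u : env -> M) :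
  Fn2 F -> Trm t -> Trm u -> Trm (fun e => F (t e) (u e)).
Proof.
  intros H Ht Hu; unfold Fn2, Trm in *.
  apply (Dfn_comp3 (fun y x x' => y = F x x')); auto.
  - apply Trm_var.
  - exact (Trm_weaken Ht).
  - exact (Trm_weaken Hu).
Qed.

(** All operations on sets are instances of this one; it is meaningful only when some
    set has the extension [P]. *)
Definition setof (P : M -> Prop) : M :=
  epsilon ZF_inhabited (fun b => forall x : M, x ∈ b <-> P x).

Lemma in_setof (P : M -> Prop) :
  (exists b : M, forall x : M, x ∈ b <-> P x) -> forall x, x ∈ setof P <-> P x.
Proof. exact (epsilon_spec ZF_inhabited (fun b => forall x, x ∈ b <-> P x)). Qed.

Lemma set_ext (x y : M) : (forall z : M, z ∈ x <-> z ∈ y) -> x = y.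
Proof. apply (zf_extensionality hM). Qed.

(** A term former given by an extension is definable, as membership in it pins
    its value down. *)
Lemma Trm_setof (P : M -> env -> Prop) :
  (forall e, exists b : M, forall x : M, x ∈ b <-> P x e) ->
  Dfn (fun e => P (e 0) (fun n => e (S n))) ->
  Trm (fun e => setof (fun x => P x e)).
Proof.
  intros H HP.
  apply Dfn_ext with (fun e => forall x : M, x ∈ e 0 <-> P x (fun n => e (S n))).
  { intros e; split; intros K.
    - apply set_ext; intros x; rewrite K.
      symmetry; apply (in_setof _ (H (fun n => e (S n)))).
    - rewrite K; apply in_setof, H. }
  apply (Dfn_all (fun x e => x ∈ e 0 <-> P x (fun n => e (S n)))), Dfn_iff.
  - apply (Dfn_mem_var 0 1).
  - apply (Dfn_rename (fun n => match n with 0 => 0 | S n => S (S n) end) HP).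
Qed.

(** In the axiom schemes the environment has one variable and parameters only. *)
Lemma Dfn_formula1 (R : M -> Prop) : Dfn (fun e => R (e 0)) ->
  exists q e0, forall x, R x <-> sat (scons x e0) q.
Proof.
  intros (p & c & H).
  exists (rename (mix (scons 0 (fun _ => 1)) (fun n => S n)) p), c.
  intros x; rewrite (H (scons x (fun _ => c 0))); apply sat_rename, mix_rename.
  - intros [|n]; auto.
  - auto.
Qed.

Lemma Dfn_formula2 (R : M -> M -> Prop) : Dfn (fun e => R (e 0) (e 1)) ->
  exists q e0, forall x y, R x y <-> sat (scons x (scons y e0)) q.
Proof.
  intros (p & c & H).
  exists (rename (mix (scons 0 (fun _ => 1)) (fun n => S (S n))) p), c.
  intros x y; rewrite (H (scons x (fun _ => y))); apply sat_rename, mix_rename.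
  - intros [|n]; auto.
  - auto.
Qed.

Lemma separation (R : M -> Prop) (a : M) : Rel1 R ->
  exists b : M, forall x, x ∈ b <-> x ∈ a /\ R x.
Proof.
  intros H; destruct (Dfn_formula1 _ H) as (q & e & Hq).
  destruct (zf_separation hM q e a) as [b Hb].
  exists b; intros x; rewrite Hb, Hq; tauto.
Qed.

Lemma replacement (F : M -> M) (a : M) : Fn F ->
  exists b : M, forall y, y ∈ b <-> exists x, x ∈ a /\ y = F x.
Proof.
  intros H; destruct (Dfn_formula2 (fun y x => y = F x) H) as (q & e & Hq).
  destruct (zf_replacement hM q e a) as [b Hb].
  { intros x _; exists (F x); split; [apply Hq; auto|].
    intros y Hy; apply Hq in Hy; auto. }
  exists b; intros y; rewrite Hb.
  split; intros (x & H1 & H2); exists x; split; auto; apply Hq; auto.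
Qed.

(** Fixing all variables but one turns them into parameters. *)
Lemma Dfn_fix (P : M -> env -> Prop) (e0 : env) :
  Dfn (fun e => P (e 0) (fun n => e (S n))) -> Rel1 (fun x => P x e0).
Proof.
  intros (p & c & H).
  exists (rename (mix (scons 0 (fun n => od (ev n))) (fun n => od (od n))) p), (mix e0 c).
  intros e; rewrite (H (scons (e 0) e0)); apply sat_rename, mix_rename.
  - intros [|n]; auto. simpl (scons _ _ _). rewrite mix_od, mix_ev; auto.
  - intros n; rewrite !mix_od; auto.
Qed.

Lemma Trm_fix (t : M -> env -> M) (e0 : env) :
  Trm (fun e => t (e 0) (fun n => e (S n))) -> Fn (fun x => t x e0).
Proof.
  intros (p & c & H).
  exists (rename (mix (scons 0 (scons 2 (fun n => od (ev n)))) (fun n => od (od n))) p),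
    (mix e0 c).
  intros e; rewrite (H (scons (e 0) (scons (e 1) e0))); apply sat_rename, mix_rename.
  - intros [|[|n]]; auto. simpl (scons _ _ _). rewrite mix_od, mix_ev; auto.
  - intros n; rewrite !mix_od; auto.
Qed.

End Definability.

(** * Set operations as definable terms *)

Create HintDb dfn.

Ltac dfn_binder := fail.

Ltac unfold_head t :=
  lazymatch t with
  | ?f _ => unfold_head f
  | _ => unfold t
  end.

(** Proves definability by recursion on the expression under the environment. The
    hint database holds the definability of named operations and relations; what is
    not found there is unfolded. Operations that bind a variable are handled by
    [dfn_binder], which is extended as they are introduced. *)
Ltac dfn :=
  intros; unfold Rel1, Rel2, Rel3, Fn, Fn2, unique; cbv beta;
  lazymatch goal with
  | |- Dfn (fun _ => ?Q) => apply Dfn_const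
  | |- Dfn (fun e => @?P e /\ @?Q e) => apply (Dfn_and (P := P) (Q := Q)); dfn
  | |- Dfn (fun e => @?P e \/ @?Q e) => apply (Dfn_or (P := P) (Q := Q)); dfn
  | |- Dfn (fun e => @?P e <-> @?Q e) => apply (Dfn_iff (P := P) (Q := Q)); dfn
  | |- Dfn (fun e => ~ @?P e) => apply (Dfn_not (P := P)); dfn
  | |- Dfn (fun e => exists x, @?P e x) => apply (Dfn_ex (fun x e => P e x)); dfn
  | |- Dfn (fun e => forall x : univ _, @?P e x) =>
      apply (Dfn_all (fun x e => P e x)); dfn
  | |- Dfn (fun e => @?P e -> @?Q e) => apply (Dfn_imp (P := P) (Q := Q)); dfn
  | |- Dfn (fun e => @?t e = @?u e) => apply (Dfn_eq (t := t) (u := u)); dfn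
  | |- Dfn (fun e => @?t e ∈ @?u e) => apply (Dfn_mem (t := t) (u := u)); dfn
  | |- Trm (fun _ => ?c) => apply Trm_const
  | |- Trm (fun e => e ?k) => apply Trm_var
  | |- _ => first [ dfn_binder | dfn_comp | dfn_unfold ]
  end
with dfn_comp :=
  match goal with
  | |- Dfn (fun e => ?R (@?t e) (@?u e) (@?v e)) =>
      apply (Dfn_comp3 R (t := t) (u := u) (v := v)); [solve [auto with dfn nocore]|dfn..]
  | |- Dfn (fun e => ?R (@?t e) (@?u e)) =>
      apply (Dfn_comp2 R (t := t) (u := u)); [solve [auto with dfn nocore]|dfn..]
  | |- Dfn (fun e => ?R (@?t e)) =>
      apply (Dfn_comp1 R (t := t)); [solve [auto with dfn nocore]|dfn]
  | |- Trm (fun e => ?F (@?t e) (@?u e)) =>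
      apply (Trm_comp2 (F := F) (t := t) (u := u)); [solve [auto with dfn nocore]|dfn..]
  | |- Trm (fun e => ?F (@?t e)) =>
      apply (Trm_comp1 (F := F) (t := t)); [solve [auto with dfn nocore]|dfn]
  end
with dfn_unfold :=
  match goal with
  | |- Dfn (fun e => ?R _) => unfold_head R; dfn
  | |- Dfn (fun e => ?R _ _) => unfold_head R; dfn
  | |- Dfn (fun e => ?R _ _ _) => unfold_head R; dfn
  | |- Dfn (fun e => ?R _ _ _ _) => unfold_head R; dfn
  | |- Trm (fun e => ?R _) => unfold_head R; dfn
  | |- Trm (fun e => ?R _ _) => unfold_head R; dfn
  | |- Trm (fun e => ?R _ _ _) => unfold_head R; dfn
  | |- Trm (fun e => ?R _ _ _ _) => unfold_head R; dfn
  end.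

Section Sets.
Context {M : set_structure} {hM : ZF M}.

Definition empty : M := setof (fun _ => False).

Lemma empty_exists : exists b : M, forall x, x ∈ b <-> False.
Proof.
  destruct (zf_infinity hM) as (a & (b & Hb & _) & _); exists b.
  intros x; split; [apply Hb|tauto].
Qed.

Lemma in_empty (x : M) : ~ x ∈ empty.
Proof. intros H; apply (in_setof _ empty_exists) in H; auto. Qed.

Definition upair (a b : M) : M := setof (fun x => x = a \/ x = b).

Lemma in_upair (a b x : M) : x ∈ upair a b <-> x = a \/ x = b.
Proof. exact (in_setof _ (zf_pairing hM a b) x). Qed.

Lemma Fn_upair : Fn2 upair.
Proof.
  refine (Trm_setof (fun x e => x = e 0 \/ x = e 1) _ _).
  - intros e; apply (zf_pairing hM).
  - dfn.
Qed.

Definition bigcup (a : M) : M := setof (fun x => exists y, y ∈ a /\ x ∈ y).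

Lemma in_bigcup (a x : M) : x ∈ bigcup a <-> exists y, y ∈ a /\ x ∈ y.
Proof. exact (in_setof _ (zf_union hM a) x). Qed.

Lemma Fn_bigcup : Fn bigcup.
Proof.
  refine (Trm_setof (fun x e => exists y, y ∈ e 0 /\ x ∈ y) _ _).
  - intros e; apply (zf_union hM).
  - dfn.
Qed.

Definition sep (a : M) (P : M -> Prop) : M := setof (fun x => x ∈ a /\ P x).

Lemma in_sep (a : M) (P : M -> Prop) (x : M) :
  Rel1 P -> (x ∈ sep a P <-> x ∈ a /\ P x).
Proof. intros H; exact (in_setof _ (separation a H) x). Qed.

Lemma Trm_sep (a : (nat -> M) -> M) (P : M -> (nat -> M) -> Prop) :
  Trm a -> Dfn (fun e => P (e 0) (fun n => e (S n))) ->
  Trm (fun e => sep (a e) (fun x => P x e)).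
Proof.
  intros Ha HP; apply (Trm_setof (fun x e => x ∈ a e /\ P x e)).
  - intros e; apply separation, Dfn_fix; auto.
  - apply Dfn_and; auto. apply Dfn_mem; [apply Trm_var|apply Trm_weaken; auto].
Qed.

Definition repl (a : M) (F : M -> M) : M :=
  setof (fun y => exists x, x ∈ a /\ y = F x).

Lemma in_repl (a : M) (F : M -> M) (y : M) :
  Fn F -> (y ∈ repl a F <-> exists x, x ∈ a /\ y = F x).
Proof. intros H; exact (in_setof _ (replacement a H) y). Qed.

Lemma Trm_repl (a : (nat -> M) -> M) (F : M -> (nat -> M) -> M) :
  Trm a -> Trm (fun e => F (e 0) (fun n => e (S n))) ->
  Trm (fun e => repl (a e) (fun x => F x e)).
Proof.
  intros Ha HF; apply (Trm_setof (fun y e => exists x, x ∈ a e /\ y = F x e)).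
  - intros e; apply replacement, Trm_fix; auto.
  - apply (Dfn_ex (fun x e => x ∈ a (fun n => e (S n)) /\ e 0 = F x (fun n => e (S n)))).
    apply Dfn_and.
    + apply Dfn_mem; [apply Trm_var|exact (Trm_weaken (Trm_weaken Ha))].
    + apply Dfn_eq; [apply Trm_var|].
      apply (Dfn_rename (fun n => match n with 0 => 0 | 1 => 1 | S (S n) => S (S (S n)) end) HF).
Qed.

End Sets.

#[global] Hint Resolve Fn_upair Fn_bigcup : dfn.

Ltac dfn_binder ::=
  lazymatch goal with
  | |- Trm (fun e => sep (@?a e) (@?P e)) =>
      apply (Trm_sep (a := a) (fun x e => P e x)); dfn
  | |- Trm (fun e => repl (@?a e) (@?F e)) =>
      apply (Trm_repl (a := a) (fun x e => F e x)); dfn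
  end.

Section Functions.
Context {M : set_structure} {hM : ZF M}.

Definition cup (a b : M) : M := bigcup (upair a b).

Lemma in_cup (a b x : M) : x ∈ cup a b <-> x ∈ a \/ x ∈ b.
Proof.
  unfold cup; rewrite in_bigcup; split.
  - intros (y & Hy & Hx); apply in_upair in Hy as [-> | ->]; auto.
  - intros [H|H]; [exists a|exists b]; rewrite in_upair; auto.
Qed.

Lemma Fn_cup : Fn2 cup.
Proof. dfn. Qed.

Definition suc (a : M) : M := cup a (upair a a).

Lemma in_suc (a x : M) : x ∈ suc a <-> x ∈ a \/ x = a.
Proof. unfold suc; rewrite in_cup, in_upair; tauto. Qed.

Lemma Fn_suc : Fn suc.
Proof. dfn. Qed.

Definition opair (a b : M) : M := upair (upair a a) (upair a b).

Lemma Fn_opair : Fn2 opair.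
Proof. dfn. Qed.
Hint Resolve Fn_opair : dfn.

Lemma is_upair_eq (a b z : M) : is_upair a b z <-> z = upair a b.
Proof.
  split.
  - intros H; apply set_ext; intros x; rewrite (H x), in_upair; tauto.
  - intros -> x; apply in_upair.
Qed.

Lemma is_opair_eq (a b p : M) : is_opair a b p <-> p = opair a b.
Proof.
  unfold is_opair, opair; split.
  - intros H; apply set_ext; intros z; rewrite (H z), in_upair, !is_upair_eq; tauto.
  - intros -> z; rewrite in_upair, !is_upair_eq; tauto.
Qed.

Lemma upair_inj (a b c : M) : upair a b = upair a c -> b = c.
Proof.
  intros H.
  assert (H1 : b ∈ upair a c) by (rewrite <- H; apply in_upair; auto).
  assert (H2 : c ∈ upair a b) by (rewrite H; apply in_upair; auto).
  apply in_upair in H1 as [->|]; auto.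
  apply in_upair in H2 as [|]; congruence.
Qed.

Lemma opair_inj (a b a' b' : M) : opair a b = opair a' b' -> a = a' /\ b = b'.
Proof.
  intros H.
  assert (E : a = a').
  { assert (K : upair a a ∈ opair a' b') by (rewrite <- H; apply in_upair; auto).
    assert (L : a' ∈ upair a a).
    { apply in_upair in K as [K|K]; rewrite K; apply in_upair; auto. }
    apply in_upair in L as [L|L]; auto. }
  subst a'; split; auto.
  apply upair_inj in H; apply upair_inj in H; auto.
Qed.

Definition prod (X Y : M) : M :=
  bigcup (repl X (fun x => repl Y (fun y => opair x y))).

Lemma Fn_prod : Fn2 prod.
Proof. dfn. Qed.

Lemma in_prod (X Y p : M) :
  p ∈ prod X Y <-> exists x y, x ∈ X /\ y ∈ Y /\ p = opair x y.
Proof.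
  unfold prod; rewrite in_bigcup; split.
  - intros (z & Hz & Hp); apply in_repl in Hz as (x & Hx & ->); [|dfn].
    apply in_repl in Hp as (y & Hy & ->); [|dfn]. eauto.
  - intros (x & y & Hx & Hy & ->); exists (repl Y (fun y => opair x y)).
    rewrite !in_repl by dfn; split; [exists x|exists y]; auto.
Qed.

Lemma opair_in_prod (X Y x y : M) : opair x y ∈ prod X Y <-> x ∈ X /\ y ∈ Y.
Proof.
  rewrite in_prod; split.
  - intros (x' & y' & Hx & Hy & E); apply opair_inj in E as [-> ->]; auto.
  - intros []; eauto.
Qed.

Lemma is_product_eq (X Y P : M) : is_product X Y P <-> P = prod X Y.
Proof.
  unfold is_product; split.
  - intros H; apply set_ext; intros p; rewrite (H p), in_prod.
    split; intros (x & y & Hx & Hy & Hp); exists x, y; rewrite is_opair_eq in *; auto.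
  - intros -> p; rewrite in_prod.
    split; intros (x & y & Hx & Hy & Hp); exists x, y; rewrite is_opair_eq in *; auto.
Qed.

(** Definite description inside a set: the union of a singleton is its element, so
    this is a definable term for every [a] and [P]. *)
Definition only (a : M) (P : M -> Prop) : M := bigcup (sep a P).

Lemma only_eq (a : M) (P : M -> Prop) (x : M) : Rel1 P ->
  x ∈ a -> P x -> (forall y, y ∈ a -> P y -> y = x) -> only a P = x.
Proof.
  intros HP Hx Px H; apply set_ext; intros z; unfold only; rewrite in_bigcup; split.
  - intros (y & Hy & Hz); apply in_sep in Hy as []; auto.
    rewrite <- (H y); auto.
  - intros Hz; exists x; split; auto. apply in_sep; auto.
Qed.

Definition app (f x : M) : M := only (bigcup (bigcup f)) (fun y => opair x y ∈ f).

Lemma Fn_app : Fn2 app.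
Proof. unfold app, only; dfn. Qed.

Lemma app_eq (f x y : M) : opair x y ∈ f ->
  (forall y', opair x y' ∈ f -> y' = y) -> app f x = y.
Proof.
  intros H1 H2; unfold app; apply only_eq; auto.
  - dfn.
  - apply in_bigcup; exists (upair x y); rewrite in_upair; split; auto.
    apply in_bigcup; exists (opair x y); split; auto.
    apply in_upair; auto.
Qed.

Definition lam (X : M) (F : M -> M) : M := repl X (fun x => opair x (F x)).

Lemma in_lam (X : M) (F : M -> M) (p : M) : Fn F ->
  (p ∈ lam X F <-> exists x, x ∈ X /\ p = opair x (F x)).
Proof.
  intros H; assert (K : Fn (fun x => opair x (F x))) by dfn.
  exact (in_repl X p K).
Qed.

Lemma app_lam (X : M) (F : M -> M) (x : M) : Fn F -> x ∈ X -> app (lam X F) x = F x.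
Proof.
  intros HF Hx; apply app_eq.
  - apply in_lam; eauto.
  - intros y Hy; apply in_lam in Hy as (x' & _ & E); auto.
    apply opair_inj in E as [-> ->]; auto.
Qed.

Definition left (p : M) : M := only (bigcup p) (fun x => exists y, p = opair x y).

Definition right (p : M) : M := only (bigcup p) (fun y => exists x, p = opair x y).

Lemma Fn_left : Fn left.
Proof. unfold left, only; dfn. Qed.

Lemma Fn_right : Fn right.
Proof. unfold right, only; dfn. Qed.

Lemma left_opair (x y : M) : left (opair x y) = x.
Proof.
  apply only_eq; eauto.
  - dfn.
  - apply in_bigcup; exists (upair x y); unfold opair; rewrite !in_upair; auto.
  - intros z _ (y' & E); apply opair_inj in E as []; auto.
Qed.

Lemma right_opair (x y : M) : right (opair x y) = y.
Proof.
  apply only_eq; eauto.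
  - dfn.
  - apply in_bigcup; exists (upair x y); unfold opair; rewrite !in_upair; auto.
  - intros z _ (y' & E); apply opair_inj in E as []; auto.
Qed.

End Functions.

#[global] Hint Resolve Fn_cup Fn_suc Fn_opair Fn_prod Fn_app Fn_left Fn_right : dfn.

Unset Strict Implicit.

(** * Comparing cardinalities by definable functions *)

Section Cardinalities.
Context {M : set_structure} {hM : ZF M}.
Implicit Types X Y Z : M.

Lemma maps_opair (f x y : M) : maps f x y <-> opair x y ∈ f.
Proof.
  split.
  - intros (p & Hp & H); apply is_opair_eq in Hp as ->; auto.
  - intros H; exists (opair x y); rewrite is_opair_eq; auto.
Qed.

Lemma maps_app (f X Y x : M) : is_function f X Y -> x ∈ X ->
  app f x ∈ Y /\ forall y, maps f x y <-> y = app f x.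
Proof.
  intros [H1 H2] Hx; destruct (H2 x Hx) as (y & Hy & U).
  assert (E : app f x = y).
  { apply app_eq; [apply maps_opair, Hy|].
    intros y' H; symmetry; apply U, maps_opair, H. }
  rewrite E; split.
  - apply maps_opair in Hy; destruct (H1 _ Hy) as (x' & y' & _ & Hy' & K).
    apply is_opair_eq, opair_inj in K as [_ ->]; auto.
  - intros y'; split; [intros H; symmetry; apply U, H|intros ->; auto].
Qed.

Lemma maps_lam (F : M -> M) X x y : Fn F ->
  (maps (lam X F) x y <-> x ∈ X /\ y = F x).
Proof.
  intros HF; rewrite maps_opair, in_lam by auto; split.
  - intros (x' & Hx & E); apply opair_inj in E as [-> ->]; auto.
  - intros [Hx ->]; eauto.
Qed.

Lemma is_function_lam (F : M -> M) X Y : Fn F ->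
  (forall x, x ∈ X -> F x ∈ Y) -> is_function (lam X F) X Y.
Proof.
  intros HF H; split.
  - intros p Hp; apply in_lam in Hp as (x & Hx & ->); auto.
    exists x, (F x); rewrite is_opair_eq; auto.
  - intros x Hx; exists (F x); split; [apply maps_lam; auto|].
    intros y Hy; apply maps_lam in Hy as []; auto.
Qed.

Lemma card_le_iff X Y : card_le X Y <-> exists F, Fn F /\
  (forall x, x ∈ X -> F x ∈ Y) /\
  (forall x x', x ∈ X -> x' ∈ X -> F x = F x' -> x = x').
Proof.
  split.
  - intros (f & Hf & I); exists (app f); split; [dfn|split].
    + intros x Hx; apply (maps_app Hf Hx).
    + intros x x' Hx Hx' E; apply (I x x' (app f x)).
      * apply (maps_app Hf Hx); auto.
      * apply (maps_app Hf Hx'); auto.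
  - intros (F & HF & H & I); exists (lam X F); split; [apply is_function_lam; auto|].
    intros x x' y Hx Hx'; apply maps_lam in Hx as [? ->], Hx' as [? ?]; auto.
Qed.

Lemma card_le_star_rel (G : M -> M -> Prop) X Y : Rel2 G ->
  (forall x, x ∈ X -> exists y, y ∈ Y /\ G y x) ->
  (forall x x' y, x ∈ X -> x' ∈ X -> y ∈ Y -> G y x -> G y x' -> x = x') ->
  card_le_star X Y.
Proof.
  intros HG H U.
  destruct (classic (exists x, x ∈ X)) as [[x0 Hx0]|N];
    [left|right; intros z Hz; apply N; eauto].
  (* Elements of [Y] outside the domain of [G] are sent to the default [x0]. *)
  set (F := fun y => only X
    (fun x => G y x \/ x = x0 /\ ~ exists x', x' ∈ X /\ G y x')).
  assert (HF : Fn F) by (unfold F, only; dfn).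
  assert (HP : forall y, Rel1 (fun x => G y x \/ x = x0 /\ ~ exists x', x' ∈ X /\ G y x'))
    by (intros y; dfn).
  assert (F1 : forall x y, y ∈ Y -> x ∈ X -> G y x -> F y = x).
  { intros x y Hy Hx K; apply only_eq; auto.
    intros x' Hx' [K'|[_ K']]; [eauto|]. exfalso; eauto. }
  exists (lam Y F); split; [apply is_function_lam; auto|].
  - intros y Hy; destruct (classic (exists x', x' ∈ X /\ G y x')) as [(x & Hx & K)|K].
    + rewrite (F1 x y); auto.
    + replace (F y) with x0; auto; symmetry; apply only_eq; auto.
      intros x Hx [K'|[K' _]]; auto. exfalso; eauto.
  - intros x Hx; destruct (H x Hx) as (y & Hy & K); exists y; apply maps_lam; auto.
    rewrite (F1 x y); auto.
Qed.

Lemma card_le_star_iff X Y : card_le_star X Y <-> exists F, Fn F /\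
  forall x, x ∈ X -> exists y, y ∈ Y /\ F y = x.
Proof.
  split.
  - intros [(f & Hf & S)|E].
    + exists (app f); split; [dfn|]. intros x Hx; destruct (S x Hx) as (y & Hy).
      exists y; assert (K : y ∈ Y).
      { apply maps_opair in Hy; destruct (proj1 Hf _ Hy) as (y' & x' & Hy' & _ & K).
        apply is_opair_eq, opair_inj in K as [-> _]; auto. }
      split; auto. symmetry; apply (maps_app Hf K), Hy.
    + exists (fun x => x); split; [dfn|]. intros x Hx; destruct (E x Hx).
  - intros (F & HF & H); apply card_le_star_rel with (fun y x => F y = x).
    + dfn.
    + auto.
    + intros; congruence.
Qed.

Lemma card_le_trans X Y Z : card_le X Y -> card_le Y Z -> card_le X Z.
Proof.
  rewrite !card_le_iff; intros (F & HF & F1 & F2) (G & HG & G1 & G2).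
  exists (fun x => G (F x)); split; [dfn|split]; auto.
Qed.

Lemma card_le_star_trans X Y Z : card_le_star X Y -> card_le_star Y Z -> card_le_star X Z.
Proof.
  rewrite !card_le_star_iff; intros (F & HF & F1) (G & HG & G1).
  exists (fun x => F (G x)); split; [dfn|].
  intros x Hx; destruct (F1 x Hx) as (y & Hy & <-), (G1 y Hy) as (z & Hz & <-); eauto.
Qed.

Lemma card_le_subset X Y : subset X Y -> card_le X Y.
Proof.
  intros H; apply card_le_iff; exists (fun x => x); split; [dfn|split]; auto.
Qed.

Lemma card_le_star_of_le X Y : card_le X Y -> card_le_star X Y.
Proof.
  rewrite card_le_iff; intros (F & HF & F1 & F2).
  apply card_le_star_rel with (fun y x => F x = y).
  - dfn.
  - eauto.
  - intros x x' y Hx Hx' _ E E'; apply F2; congruence.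
Qed.

Lemma equipotent_le X Y : equipotent X Y -> card_le X Y /\ card_le Y X.
Proof.
  intros (f & Hi & Hs); split; [exists f; auto|].
  apply card_le_iff; exists (fun y => only X (fun x => app f x = y)).
  assert (K : forall y, y ∈ Y -> exists x, x ∈ X /\ app f x = y /\
     only X (fun x => app f x = y) = x).
  { intros y Hy; destruct Hi as [Hf I], (proj2 Hs y Hy) as [x Hx].
    assert (Hx' : x ∈ X).
    { apply maps_opair in Hx; destruct (proj1 Hf _ Hx) as (y' & x' & Hy' & _ & K).
      apply is_opair_eq, opair_inj in K as [-> _]; auto. }
    assert (E : app f x = y) by (symmetry; apply (maps_app Hf Hx'), Hx).
    exists x; split; [auto|split;[auto|]]. apply only_eq; auto; [dfn|].
    intros z Hz Ez; apply (I z x y); auto. apply (maps_app Hf Hz); auto. }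
  split; [unfold only; dfn|split].
  - intros y Hy; destruct (K y Hy) as (x & Hx & _ & ->); auto.
  - intros y y' Hy Hy'; destruct (K y Hy) as (x & Hx & <- & ->),
      (K y' Hy') as (x' & Hx' & <- & ->); congruence.
Qed.

Lemma equipotent_iff X Y : equipotent X Y <-> exists F, Fn F /\
  (forall x, x ∈ X -> F x ∈ Y) /\
  (forall x x', x ∈ X -> x' ∈ X -> F x = F x' -> x = x') /\
  (forall y, y ∈ Y -> exists x, x ∈ X /\ F x = y).
Proof.
  split.
  - intros (f & [Hf I] & [_ S]); exists (app f); split; [dfn|split; [|split]].
    + intros x Hx; apply (maps_app Hf Hx).
    + intros x x' Hx Hx' E; apply (I x x' (app f x)).
      * apply (maps_app Hf Hx); auto.
      * apply (maps_app Hf Hx'); auto.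
    + intros y Hy; destruct (S y Hy) as [x Hx]; exists x.
      assert (Hx' : x ∈ X).
      { apply maps_opair in Hx; destruct (proj1 Hf _ Hx) as (y' & x' & Hy' & _ & K).
        apply is_opair_eq, opair_inj in K as [-> _]; auto. }
      split; auto. symmetry; apply (maps_app Hf Hx'), Hx.
  - intros (F & HF & F1 & F2 & F3); exists (lam X F).
    assert (Hf : is_function (lam X F) X Y) by (apply is_function_lam; auto).
    split; split; auto.
    + intros x x' y Hx Hx'; apply maps_lam in Hx as [? ->], Hx' as [? ?]; auto.
    + intros y Hy; destruct (F3 y Hy) as (x & Hx & <-); exists x; apply maps_lam; auto.
Qed.

End Cardinalities.

(** * Ordinals *)

Section Ordinals.
Context {M : set_structure} {hM : ZF M}.

Lemma Rel1_ordinal : Rel1 (ordinal (M := M)).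
Proof. dfn. Qed.
Hint Resolve Rel1_ordinal : dfn.

Lemma ord_irrefl (a : M) : ordinal a -> ~ a ∈ a.
Proof. intros (_ & H & _) K; exact (H a K K). Qed.

Lemma ord_trans (a x y : M) : ordinal a -> x ∈ a -> y ∈ x -> y ∈ a.
Proof. intros (H & _) Hx Hy; exact (H x Hx y Hy). Qed.

Lemma ord_mem (a x : M) : ordinal a -> x ∈ a -> ordinal x.
Proof.
  intros Ha Hx.
  assert (T : forall y, y ∈ x -> y ∈ a) by (intros; eapply ord_trans; eauto).
  destruct Ha as (H1 & H2 & H3 & H4 & H5).
  split; [|split; [|split; [|split]]]; auto.
  - intros y Hy z Hz; apply (H3 z y x); auto. apply (H1 y); auto.
  - intros y z w Hy Hz Hw; apply H3; auto.
  - intros b Hb; apply H5; intros y Hy; auto.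
Qed.

(** A transitive proper subset is the first element that it misses. *)
Lemma transitive_subset_ord (a d : M) : ordinal a -> subset d a ->
  (forall x, x ∈ d -> subset x d) -> d = a \/ d ∈ a.
Proof.
  intros (H1 & H2 & H3 & H4 & H5) Hd Ht.
  destruct (classic (exists x, x ∈ a /\ ~ x ∈ d)) as [(x & Hx & Nx)|N].
  - right.
    assert (R : Rel1 (fun y => ~ y ∈ d)) by dfn.
    destruct (H5 (sep a (fun y => ~ y ∈ d))) as (m & Hm & Lm).
    { intros y Hy; apply in_sep in Hy as []; auto. }
    { exists x; apply in_sep; auto. }
    apply in_sep in Hm as [Hm Nm]; auto.
    replace d with m; auto; apply set_ext; intros y; split; intros Hy.
    + apply NNPP; intros Ny.
      assert (Ya : y ∈ a) by (apply (H1 m); auto).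
      destruct (Lm y) as [-> | K]; [apply in_sep; auto| |].
      * exact (H2 y Ya Hy).
      * exact (H2 m Hm (H3 m y m Hm Ya Hm K Hy)).
    + destruct (H4 y m (Hd y Hy) Hm) as [K|[-> |K]]; auto; try tauto.
      destruct Nm; apply (Ht y Hy); auto.
  - left; apply set_ext; intros x; split; [apply Hd|intros Hx].
    apply NNPP; intros Nx; apply N; eauto.
Qed.

Lemma ord_total (a b : M) : ordinal a -> ordinal b -> a ∈ b \/ a = b \/ b ∈ a.
Proof.
  intros Ha Hb; assert (R : Rel1 (fun x => x ∈ b)) by dfn.
  set (d := sep a (fun x => x ∈ b)).
  assert (Hd : forall x, x ∈ d <-> x ∈ a /\ x ∈ b) by (intros x; exact (in_sep a x R)).
  assert (T : forall x, x ∈ d -> subset x d).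
  { intros x Hx y Hy; apply Hd in Hx as []; apply Hd; split; eapply ord_trans; eauto. }
  destruct (transitive_subset_ord (d := d) Ha) as [E|E]; auto.
  { intros x Hx; apply Hd in Hx; tauto. }
  - destruct (transitive_subset_ord (d := d) Hb) as [E'|E']; auto.
    { intros x Hx; apply Hd in Hx; tauto. }
    + right; left; congruence.
    + left; congruence.
  - destruct (transitive_subset_ord (d := d) Hb) as [E'|E']; auto.
    { intros x Hx; apply Hd in Hx; tauto. }
    + right; right; congruence.
    + exfalso; apply (ord_irrefl (ord_mem Ha E)), Hd; auto.
Qed.

Lemma ord_le_iff (a b : M) : ordinal a -> ordinal b -> (ord_le a b <-> subset a b).
Proof.
  intros Ha Hb; split.
  - intros [H | ->] x Hx; auto. eapply ord_trans; eauto.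
  - intros H; destruct (ord_total Ha Hb) as [K|[K|K]]; [left|right|]; auto.
    destruct (ord_irrefl Hb); auto.
Qed.

Lemma ord_not_le (a b : M) : ordinal a -> ordinal b -> (~ ord_le a b <-> b ∈ a).
Proof.
  intros Ha Hb; split.
  - intros N; destruct (ord_total Ha Hb) as [K|[K|K]]; auto; destruct N;
      [left|right]; auto.
  - intros H K; apply ord_le_iff in K; auto. apply (ord_irrefl Hb), K, H.
Qed.

Lemma ord_not_lt (a b : M) : ordinal a -> ordinal b -> (~ a ∈ b <-> ord_le b a).
Proof.
  intros Ha Hb; rewrite <- (ord_not_le Hb Ha); split; [apply NNPP|tauto].
Qed.

Lemma ord_le_refl (a : M) : ord_le a a.
Proof. right; auto. Qed.

Lemma ord_le_trans (a b c : M) : ordinal c -> ord_le a b -> ord_le b c -> ord_le a c.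
Proof.
  intros Hc [H | ->] [K | ->]; [left|left|left|right]; auto.
  eapply ord_trans; eauto.
Qed.

Lemma ord_le_lt_trans (a b c : M) : ordinal c -> ord_le a b -> b ∈ c -> a ∈ c.
Proof. intros Hc [H | ->] K; auto. eapply ord_trans; eauto. Qed.

Lemma ord_lt_le_trans (a b c : M) : ordinal c -> a ∈ b -> ord_le b c -> a ∈ c.
Proof. intros Hc H [K | <-]; auto. eapply ord_trans; eauto. Qed.

Lemma ord_le_antisym (a b : M) : ordinal a -> ordinal b -> ord_le a b -> ord_le b a -> a = b.
Proof.
  intros Ha Hb [H|H] [K|K]; auto.
  destruct (ord_irrefl Ha); eapply ord_trans; eauto.
Qed.

Lemma ord_least (P : M -> Prop) (a : M) : Rel1 P -> ordinal a -> P a ->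
  exists b, is_least_ordinal P b.
Proof.
  intros HP Ha Pa.
  destruct (classic (exists x, x ∈ a /\ P x)) as [(x & Hx & Px)|N].
  - destruct Ha as (H1 & H2 & H3 & H4 & H5).
    assert (Ha : ordinal a) by (split; auto).
    destruct (H5 (sep a P)) as (m & Hm & Lm).
    { intros y Hy; apply in_sep in Hy as []; auto. }
    { exists x; apply in_sep; auto. }
    apply in_sep in Hm as [Hm Pm]; auto.
    exists m; split; [eapply ord_mem; eauto|split; auto].
    intros b Hb Pb; destruct (ord_total Hb Ha) as [K|K].
    + destruct (Lm b); [apply in_sep; auto| |]; [right|left]; auto.
    + left; destruct K as [-> |K]; auto. eapply ord_trans; eauto.
  - exists a; split; auto; split; auto.
    intros b Hb Pb; apply ord_not_lt; auto. intros K; apply N; eauto.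
Qed.

Lemma ord_induction (P : M -> Prop) : Rel1 P ->
  (forall a, ordinal a -> (forall b, b ∈ a -> P b) -> P a) ->
  forall a, ordinal a -> P a.
Proof.
  intros HP H a Ha; apply NNPP; intros N.
  destruct (@ord_least (fun x => ~ P x) a) as (m & Hm & Nm & Lm); auto; [dfn|].
  apply Nm, H; auto. intros b Hb; apply NNPP; intros Nb.
  apply (ord_irrefl Hm), (ord_le_lt_trans (b := b) Hm); auto.
  apply Lm; auto. eapply ord_mem; eauto.
Qed.

Lemma transitive_ordinal (a : M) : (forall x, x ∈ a -> ordinal x) ->
  (forall x, x ∈ a -> subset x a) -> ordinal a.
Proof.
  intros Ho Ht; split; [|split; [|split; [|split]]]; auto.
  - intros x Hx; apply ord_irrefl; auto.
  - intros x y z Hx Hy Hz H K; eapply ord_trans; eauto.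
  - intros x y Hx Hy; apply ord_total; auto.
  - intros b Hb (x & Hx).
    destruct (@ord_least (fun x => x ∈ b) x) as (m & Hm & Nm & Lm); auto; [dfn|].
    exists m; split; auto. intros y Hy; destruct (Lm y); auto.
Qed.

Lemma ordinal_empty : ordinal empty.
Proof. apply transitive_ordinal; intros x Hx; destruct (in_empty _ Hx). Qed.

Lemma ordinal_suc (a : M) : ordinal a -> ordinal (suc a).
Proof.
  intros Ha; apply transitive_ordinal; intros x Hx; apply in_suc in Hx as [Hx | ->]; auto.
  - eapply ord_mem; eauto.
  - intros y Hy; apply in_suc; left; eapply ord_trans; eauto.
  - intros y Hy; apply in_suc; auto.
Qed.

Lemma in_suc_le (a x : M) : x ∈ suc a <-> ord_le x a.
Proof. apply in_suc. Qed.

Lemma suc_le (a b : M) : ordinal a -> ordinal b -> a ∈ b -> ord_le (suc a) b.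
Proof.
  intros Ha Hb H; apply ord_le_iff; auto using ordinal_suc.
  intros x Hx; apply in_suc in Hx as [Hx | ->]; auto. eapply ord_trans; eauto.
Qed.

Lemma ordinal_bigcup (A : M) : (forall x, x ∈ A -> ordinal x) -> ordinal (bigcup A).
Proof.
  intros H; apply transitive_ordinal; intros x Hx; apply in_bigcup in Hx as (y & Hy & Hx).
  - eapply ord_mem; eauto.
  - intros z Hz; apply in_bigcup; exists y; split; auto. eapply ord_trans; eauto.
Qed.

Lemma bigcup_upper (A a : M) : (forall x, x ∈ A -> ordinal x) -> a ∈ A ->
  ord_le a (bigcup A).
Proof.
  intros H Ha; apply ord_le_iff; auto using ordinal_bigcup.
  intros x Hx; apply in_bigcup; eauto.
Qed.

(** The least ordinal satisfying [P], or the empty set when there is none: the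
    proviso makes it a set, hence a definable term, in every case. *)
Definition lst (P : M -> Prop) : M := setof (fun x =>
  (exists a, ordinal a /\ P a) /\ forall a, ordinal a -> P a -> x ∈ a).

Lemma lst_exists (P : M -> Prop) : Rel1 P -> exists b : M, forall x, x ∈ b <->
  (exists a, ordinal a /\ P a) /\ forall a, ordinal a -> P a -> x ∈ a.
Proof.
  intros HP; destruct (classic (exists a, ordinal a /\ P a)) as [(a & Ha & Pa)|N].
  - destruct (ord_least HP Ha Pa) as (m & Hm & Pm & Lm); exists m; intros x; split.
    + intros Hx; split; eauto. intros b Hb Pb; apply (ord_lt_le_trans Hb Hx); auto.
    + intros [_ H]; auto.
  - exists empty; intros x; split; [intros H; destruct (in_empty _ H)|tauto].
Qed.

Lemma lst_eq (P : M -> Prop) (a : M) : Rel1 P -> is_least_ordinal P a -> lst P = a.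
Proof.
  intros HP (Ha & Pa & La); apply set_ext; intros x; unfold lst.
  rewrite (in_setof _ (lst_exists HP) x); split.
  - intros [_ H]; auto.
  - intros Hx; split; eauto. intros b Hb Pb; apply (ord_lt_le_trans Hb Hx); auto.
Qed.

Lemma lst_least (P : M -> Prop) (a : M) : Rel1 P -> ordinal a -> P a ->
  is_least_ordinal P (lst P).
Proof.
  intros HP Ha Pa; destruct (ord_least HP Ha Pa) as [m Hm]; rewrite (lst_eq HP Hm); auto.
Qed.

Lemma Trm_lst (P : M -> (nat -> M) -> Prop) :
  Dfn (fun e => P (e 0) (fun n => e (S n))) -> Trm (fun e => lst (fun x => P x e)).
Proof.
  intros HP; apply (Trm_setof (fun x e =>
    (exists a, ordinal a /\ P a e) /\ forall a, ordinal a -> P a e -> x ∈ a)).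
  - intros e; apply lst_exists, Dfn_fix, HP.
  - assert (K : Dfn (fun e => P (e 0) (fun n => e (S (S n))))).
    { apply (Dfn_rename (fun n => match n with 0 => 0 | S n => S (S n) end) HP). }
    apply Dfn_and.
    + apply (Dfn_ex (fun a e => ordinal a /\ P a (fun n => e (S n)))).
      apply Dfn_and; [dfn|exact K].
    + apply (Dfn_all (fun a e => ordinal a -> P a (fun n => e (S n)) -> e 0 ∈ a)).
      apply Dfn_imp; [dfn|apply Dfn_imp; [exact K|dfn]].
Qed.

End Ordinals.
#[global] Hint Resolve Rel1_ordinal : dfn.

Ltac dfn_binder ::=
  lazymatch goal with
  | |- Trm (fun e => sep (@?a e) (@?P e)) =>
      apply (Trm_sep (a := a) (fun x e => P e x)); dfn
  | |- Trm (fun e => repl (@?a e) (@?F e)) =>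
      apply (Trm_repl (a := a) (fun x e => F e x)); dfn
  | |- Trm (fun e => lst (@?P e)) => apply (Trm_lst (P := fun x e => P e x)); dfn
  end.

(** * Ranks in well-orders and order types *)

Section Ranks.
Context {M : set_structure} {hM : ZF M}.

Record well_order (X : M) (R : M -> M -> Prop) : Prop := {
  wo_rel : Rel2 R;
  wo_trans : forall x y z, x ∈ X -> y ∈ X -> z ∈ X -> R x y -> R y z -> R x z;
  wo_total : forall x y, x ∈ X -> y ∈ X -> R x y \/ x = y \/ R y x;
  wo_irrefl : forall x, x ∈ X -> ~ R x x;
  wo_least : forall P, Rel1 P -> (exists x, x ∈ X /\ P x) ->
    exists m, m ∈ X /\ P m /\ forall y, y ∈ X -> P y -> ~ R y m
}.

Definition embeds_below (X : M) (R : M -> M -> Prop) (x a : M) : Prop :=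
  exists f, forall y, y ∈ X -> R y x ->
    app f y ∈ a /\ forall z, z ∈ X -> R z y -> app f z ∈ app f y.

(** Minimizing over all increasing maps gives the same ordinal as collapsing the
    initial segment, without a recursion theorem. *)
Definition rank (X : M) (R : M -> M -> Prop) (x : M) : M :=
  lst (embeds_below X R x).

Section Order.
Variables (X : M) (R : M -> M -> Prop).
Hypothesis W : well_order X R.
Let HR : Rel2 R := wo_rel W.

Lemma Rel2_embeds_below : Rel2 (embeds_below X R).
Proof. dfn. Qed.

Hint Resolve Rel2_embeds_below : dfn.

Lemma Rel1_embeds_below (x : M) : Rel1 (embeds_below X R x).
Proof. dfn. Qed.

Lemma Fn_rank : Fn (rank X R).
Proof. dfn. Qed.
Hint Resolve Fn_rank : dfn.

Lemma rank_mono_of (x y : M) : x ∈ X -> y ∈ X -> R y x ->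
  (exists a, ordinal a /\ embeds_below X R x a) -> rank X R y ∈ rank X R x.
Proof.
  intros Hx Hy H (a & Ha & E).
  destruct (lst_least (Rel1_embeds_below x) Ha E) as (O & (f & Hf) & _).
  fold (rank X R x) in *.
  destruct (Hf y Hy H) as [F1 F2].
  assert (Of : ordinal (app f y)) by (eapply ord_mem; eauto).
  assert (K : embeds_below X R y (app f y)).
  { exists f; intros z Hz Hzy; split; auto.
    apply (Hf z Hz); apply (wo_trans W) with y; auto. }
  apply (ord_le_lt_trans O (b := app f y)); auto.
  apply (lst_least (Rel1_embeds_below y) Of K); auto.
Qed.

(** At a first failure [x], all ranks below [x] are defined, and the supremum of their
    successors bounds them. *)
Lemma embeds_below_exists (x : M) : x ∈ X -> exists a, ordinal a /\ embeds_below X R x a.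
Proof.
  intros Hx; apply NNPP; intros N; pose proof Fn_rank as HF.
  destruct (@wo_least _ _ W (fun x => ~ exists a, ordinal a /\ embeds_below X R x a))
    as (m & Hm & Nm & Lm); [dfn|eauto|].
  assert (G : forall y, y ∈ X -> R y m -> exists a, ordinal a /\ embeds_below X R y a).
  { intros y Hy Hym; apply NNPP; intros Ny; apply (Lm y); auto. }
  assert (HI : Rel1 (fun y => R y m)) by dfn.
  assert (HS : Fn (fun y => suc (rank X R y))) by dfn.
  set (A := repl (sep X (fun y => R y m)) (fun y => suc (rank X R y))).
  assert (OA : forall a, a ∈ A -> ordinal a).
  { intros a Ha; apply (in_repl _ a HS) in Ha as (y & Hy & ->).
    apply in_sep in Hy as [Hy Hym]; auto.
    destruct (G y Hy Hym) as (a & Ha & E); apply ordinal_suc, (lst_least (Rel1_embeds_below y) Ha E). }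
  apply Nm; exists (bigcup A); split; [apply ordinal_bigcup, OA|].
  exists (lam X (rank X R)); intros y Hy Hym; rewrite !app_lam by auto; split.
  - apply in_bigcup; exists (suc (rank X R y)); split; [|apply in_suc; auto].
    apply (in_repl _ _ HS); exists y; rewrite in_sep; auto.
  - intros z Hz Hzy; rewrite app_lam; auto. apply rank_mono_of; auto.
Qed.

Lemma rank_spec (x : M) : x ∈ X -> is_least_ordinal (embeds_below X R x) (rank X R x).
Proof.
  intros Hx; destruct (embeds_below_exists Hx) as (a & Ha & E).
  apply (lst_least (Rel1_embeds_below x) Ha E).
Qed.

Lemma ordinal_rank (x : M) : x ∈ X -> ordinal (rank X R x).
Proof. intros Hx; apply (rank_spec Hx). Qed.

Lemma rank_mono (x y : M) : x ∈ X -> y ∈ X -> R y x -> rank X R y ∈ rank X R x.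
Proof. intros; apply rank_mono_of; auto using embeds_below_exists. Qed.

Lemma rank_inj (x y : M) : x ∈ X -> y ∈ X -> rank X R x = rank X R y -> x = y.
Proof.
  intros Hx Hy E; destruct (wo_total W Hx Hy) as [H|[H|H]]; auto; exfalso;
    apply rank_mono in H; auto; rewrite E in H;
    revert H; apply ord_irrefl, ordinal_rank; auto.
Qed.

(** Were the value [b] below [rank x] skipped, the first element of rank above
    [b] would already embed into [b]. *)
Lemma rank_initial (x b : M) : x ∈ X -> b ∈ rank X R x ->
  exists y, y ∈ X /\ R y x /\ rank X R y = b.
Proof.
  intros Hx Hb; apply NNPP; intros N; pose proof Fn_rank as HF.
  assert (Ob : ordinal b) by (eapply ord_mem; eauto using ordinal_rank).
  destruct (@wo_least _ _ W (fun y => (y = x \/ R y x) /\ b ∈ rank X R y))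
    as (m & Hm & (K & Nm) & Lm); [dfn|eauto|].
  assert (E : embeds_below X R m b).
  { exists (lam X (rank X R)); intros y Hy Hym; rewrite !app_lam by auto; split.
    - assert (Hyx : R y x) by (destruct K as [-> |K]; auto; apply (wo_trans W) with m; auto).
      assert (Oy := ordinal_rank Hy).
      destruct (ord_total Oy Ob) as [L|[L|L]]; auto; exfalso; eauto.
      apply (Lm y); auto.
    - intros z Hz Hzy; rewrite app_lam; auto. apply rank_mono; auto. }
  destruct (rank_spec Hm) as (_ & _ & L).
  apply (ord_irrefl Ob), (ord_lt_le_trans Ob Nm), L; auto.
Qed.

End Order.

(** For a set of ordinals, [pos B b] is the index of [b] in the increasing enumeration
    of [B]. *)
Definition pos (B b : M) : M := rank B (fun y x => y ∈ x) b.
Definition otp (B : M) : M := repl B (pos B).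

Lemma Fn_pos : Fn2 pos.
Proof. unfold pos, rank, embeds_below; dfn. Qed.
Hint Resolve Fn_pos : dfn.

Lemma Fn1_pos (B : M) : Fn (pos B).
Proof. dfn. Qed.

Hint Resolve Fn1_pos : dfn.

Lemma Fn_otp : Fn otp.
Proof. dfn. Qed.

Lemma well_order_mem (B a : M) : ordinal a -> subset B a ->
  well_order B (fun y x => y ∈ x).
Proof.
  intros Ha HB; assert (O : forall x, x ∈ B -> ordinal x).
  { intros; eapply ord_mem; eauto. }
  split.
  - dfn.
  - intros x y z Hx Hy Hz; eauto using ord_trans.
  - intros x y Hx Hy; apply ord_total; auto.
  - intros x Hx; apply ord_irrefl; auto.
  - intros P HP (x & Hx & Px).
    destruct (@ord_least M _ (fun x => x ∈ B /\ P x) x) as (m & Om & [Bm Pm] & Lm); auto.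
    { dfn. }
    exists m; split; auto; split; auto.
    intros y By Py; apply ord_not_lt; auto.
Qed.

Section OrderType.
Variables (a B : M).
Hypotheses (Ha : ordinal a) (HB : subset B a).
Let W := well_order_mem Ha HB.

Lemma in_otp (x : M) : x ∈ otp B <-> exists b, b ∈ B /\ x = pos B b.
Proof. apply in_repl, Fn1_pos. Qed.

Lemma pos_in_otp (b : M) : b ∈ B -> pos B b ∈ otp B.
Proof. intros H; apply in_otp; eauto. Qed.

Lemma ordinal_pos (b : M) : b ∈ B -> ordinal (pos B b).
Proof. apply (ordinal_rank W). Qed.

Lemma pos_mono (b c : M) : b ∈ B -> c ∈ B -> b ∈ c -> pos B b ∈ pos B c.
Proof. intros; apply (rank_mono W); auto. Qed.

Lemma pos_inj (b c : M) : b ∈ B -> c ∈ B -> pos B b = pos B c -> b = c.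
Proof. apply (rank_inj W). Qed.

Lemma ordinal_otp : ordinal (otp B).
Proof.
  apply transitive_ordinal; intros x Hx; apply in_otp in Hx as (b & Hb & ->).
  - apply ordinal_pos; auto.
  - intros y Hy; apply (rank_initial W Hb) in Hy as (c & Hc & _ & <-).
    apply pos_in_otp; auto.
Qed.

Lemma pos_le (b : M) : b ∈ B -> ord_le (pos B b) b.
Proof.
  intros Hb; apply (rank_spec W Hb); [eapply ord_mem; eauto|].
  exists (lam B (fun x => x)); intros y Hy H; rewrite !app_lam by (auto; dfn); split; auto.
  intros z Hz K; rewrite app_lam; auto; dfn.
Qed.

Lemma otp_le : ord_le (otp B) a.
Proof.
  apply ord_le_iff; auto using ordinal_otp.
  intros x Hx; apply in_otp in Hx as (b & Hb & ->).
  apply (ord_le_lt_trans Ha (pos_le Hb)), HB, Hb.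
Qed.

Lemma card_le_otp : card_le B (otp B).
Proof.
  apply card_le_iff; exists (pos B); split; [apply Fn1_pos|split].
  - apply pos_in_otp.
  - apply pos_inj.
Qed.

Lemma card_otp_le : card_le (otp B) B.
Proof.
  assert (HP : forall x, Rel1 (fun b => pos B b = x)) by (intros; dfn).
  assert (K : forall b, b ∈ B -> only B (fun b' => pos B b' = pos B b) = b).
  { intros b Hb; apply only_eq; auto. intros; apply pos_inj; auto. }
  apply card_le_iff; exists (fun x => only B (fun b => pos B b = x)).
  split; [unfold only; dfn|split].
  - intros x Hx; apply in_otp in Hx as (b & Hb & ->); rewrite K; auto.
  - intros x y Hx Hy E; apply in_otp in Hx as (b & Hb & ->), Hy as (c & Hc & ->).
    rewrite !K in E; congruence.
Qed.

Lemma otp_mono (B' : M) : subset B' B -> ord_le (otp B') (otp B).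
Proof.
  intros S; assert (HB' : subset B' a) by (intros x Hx; auto).
  assert (W' := well_order_mem Ha HB').
  assert (O' : ordinal (otp B')).
  { apply transitive_ordinal; intros x Hx; apply (in_repl _ _ (Fn1_pos B')) in Hx as (b & Hb & ->).
    - apply (ordinal_rank W'); auto.
    - intros y Hy; apply (rank_initial W' Hb) in Hy as (c & Hc & _ & <-).
      apply (in_repl _ _ (Fn1_pos B')); exists c; auto. }
  apply ord_le_iff; auto using ordinal_otp.
  intros x Hx; apply (in_repl _ _ (Fn1_pos B')) in Hx as (b & Hb & ->).
  apply (ord_le_lt_trans ordinal_otp (b := pos B b)); [|apply pos_in_otp; auto].
  apply (rank_spec W' Hb); [apply ordinal_pos; auto|].
  exists (lam B' (pos B)); intros y Hy H; rewrite !app_lam by (auto using Fn1_pos); split.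
  - apply pos_mono; auto.
  - intros z Hz K; rewrite app_lam; auto using Fn1_pos. apply pos_mono; auto.
Qed.

End OrderType.
End Ranks.
#[global] Hint Resolve Fn_pos Fn1_pos Fn_otp : dfn.

(** * Cardinals and the product of two ordinals *)

Section Cardinals.
Context {M : set_structure} {hM : ZF M}.

Lemma equipotent_otp (F : M -> M) (X a : M) : Fn F -> ordinal a ->
  (forall x, x ∈ X -> F x ∈ a) ->
  (forall x x', x ∈ X -> x' ∈ X -> F x = F x' -> x = x') ->
  equipotent (otp (repl X F)) X.
Proof.
  intros HF Ha F1 F2; set (B := repl X F).
  assert (HB : subset B a).
  { intros y Hy; apply (in_repl _ _ HF) in Hy as (x & Hx & ->); auto. }
  assert (BF : forall x, x ∈ X -> F x ∈ B).
  { intros x Hx; apply (in_repl _ _ HF); eauto. }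
  assert (HP : forall y, Rel1 (fun x => pos B (F x) = y)) by (intros; dfn).
  assert (K : forall x, x ∈ X -> only X (fun x' => pos B (F x') = pos B (F x)) = x).
  { intros x Hx; apply only_eq; auto. intros x' Hx' E.
    apply F2; auto. apply (pos_inj Ha HB) in E; auto. }
  assert (L : forall y, y ∈ otp B -> exists x, x ∈ X /\ y = pos B (F x)).
  { intros y Hy; apply in_otp in Hy as (b & Hb & ->).
    apply (in_repl _ _ HF) in Hb as (x & Hx & ->); eauto. }
  apply equipotent_iff; exists (fun y => only X (fun x => pos B (F x) = y)).
  split; [unfold only; dfn|split; [|split]].
  - intros y Hy; destruct (L y Hy) as (x & Hx & ->); rewrite K; auto.
  - intros y y' Hy Hy' E; destruct (L y Hy) as (x & Hx & ->), (L y' Hy') as (x' & Hx' & ->).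
    rewrite !K in E; congruence.
  - intros x Hx; exists (pos B (F x)); split; [|auto]. apply in_otp; eauto.
Qed.

Lemma equipotent_ordinal (X a : M) : ordinal a -> card_le X a ->
  exists r, ordinal r /\ ord_le r a /\ equipotent r X.
Proof.
  intros Ha (F & HF & F1 & F2)%card_le_iff.
  assert (HB : subset (repl X F) a).
  { intros y Hy; apply (in_repl _ _ HF) in Hy as (x & Hx & ->); auto. }
  exists (otp (repl X F)); split; [eapply ordinal_otp; eauto|split].
  - apply otp_le; auto.
  - eapply equipotent_otp; eauto.
Qed.

Lemma card_le_star_ordinal (X a : M) : ordinal a -> card_le_star X a -> card_le X a.
Proof.
  intros Ha (F & HF & H)%card_le_star_iff.
  assert (K : forall x, x ∈ X ->
    is_least_ordinal (fun y => y ∈ a /\ F y = x) (lst (fun y => y ∈ a /\ F y = x))).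
  { intros x Hx; destruct (H x Hx) as (y & Hy & E).
    apply (@lst_least M _ _ y); [dfn|eapply ord_mem; eauto|auto]. }
  apply card_le_iff; exists (fun x => lst (fun y => y ∈ a /\ F y = x)).
  split; [dfn|split].
  - intros x Hx; apply (K x Hx).
  - intros x x' Hx Hx' E; destruct (K x Hx) as (_ & [_ <-] & _), (K x' Hx') as (_ & [_ <-] & _).
    congruence.
Qed.

Lemma cardinal_not_le (k b : M) : cardinal k -> b ∈ k -> ~ card_le k b.
Proof.
  intros [Ok Hk] Hb H.
  destruct (equipotent_ordinal (ord_mem Ok Hb) H) as (r & Or & L & E).
  apply (Hk r); auto. apply (ord_le_lt_trans Ok L Hb).
Qed.

Lemma cardinal_intro (k : M) : ordinal k -> (forall b, b ∈ k -> ~ card_le k b) -> cardinal k.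
Proof.
  intros Ok H; split; auto. intros b Hb E; apply (H b Hb), (equipotent_le E).
Qed.

Lemma card_le_of_ord_le (a b : M) : ordinal a -> ordinal b -> ord_le a b -> card_le a b.
Proof. intros Ha Hb H; apply card_le_subset, ord_le_iff; auto. Qed.

Lemma ord_lt_of_not_card_le (a b : M) : ordinal a -> ordinal b -> ~ card_le b a -> a ∈ b.
Proof.
  intros Ha Hb H; apply ord_not_le; auto. intros K; apply H, card_le_of_ord_le; auto.
Qed.

Lemma cardinality_exists (a : M) : ordinal a ->
  exists k, cardinal k /\ ord_le k a /\ card_le a k /\ card_le k a.
Proof.
  intros Ha; destruct (@ord_least M _ (fun k => card_le a k) a) as (k & Ok & Hk & Lk); auto.
  { dfn. }
  { apply card_le_of_ord_le; auto using ord_le_refl. }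
  assert (L : ord_le k a) by (apply Lk; auto; apply card_le_of_ord_le; auto using ord_le_refl).
  exists k; split; [|split; [|split]]; auto using card_le_of_ord_le.
  apply cardinal_intro; auto. intros b Hb K.
  assert (Ob := ord_mem Ok Hb).
  apply (ord_irrefl Ob), (ord_lt_le_trans Ob Hb), Lk; auto. eapply card_le_trans; eauto.
Qed.

Lemma limit_suc (a x : M) : limit_ordinal a -> x ∈ a -> suc x ∈ a.
Proof.
  intros (Ha & _ & H) Hx; destruct (H x Hx) as (y & Hy & K).
  apply (ord_le_lt_trans Ha (b := y)); auto.
  apply suc_le; eauto using ord_mem.
Qed.

Lemma not_limit_cases (a : M) : ordinal a -> ~ limit_ordinal a ->
  a = empty \/ exists j, ordinal j /\ a = suc j.
Proof.
  intros Ha N; destruct (classic (exists x, x ∈ a)) as [E|E].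
  - right; apply NNPP; intros K; apply N; split; auto; split; auto.
    intros x Hx; apply NNPP; intros L; apply K.
    assert (Ox := ord_mem Ha Hx); exists x; split; auto.
    apply ord_le_antisym; auto using ordinal_suc.
    + apply ord_not_lt; auto using ordinal_suc. intros Hs; apply L.
      exists (suc x); split; auto. apply in_suc; auto.
    + apply suc_le; auto.
  - left; apply set_ext; intros x; split; intros Hx.
    + destruct E; eauto.
    + destruct (in_empty _ Hx).
Qed.

Lemma ord_max (k a b : M) : ordinal k -> a ∈ k -> b ∈ k ->
  exists c, c ∈ k /\ ord_le a c /\ ord_le b c.
Proof.
  intros Ok Ha Hb; assert (Oa := ord_mem Ok Ha); assert (Ob := ord_mem Ok Hb).
  destruct (ord_total Oa Ob) as [H|[H|H]].
  - exists b; split; auto; split; [left|right]; auto.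
  - exists b; split; auto; split; right; auto.
  - exists a; split; auto; split; [right|left]; auto.
Qed.

Lemma subset_prod (X Y X' Y' : M) : subset X X' -> subset Y Y' ->
  subset (prod X Y) (prod X' Y').
Proof.
  intros H K p Hp; apply in_prod in Hp as (x & y & Hx & Hy & ->).
  apply opair_in_prod; auto.
Qed.

Lemma card_le_prod (X Y X' Y' : M) : card_le X X' -> card_le Y Y' ->
  card_le (prod X Y) (prod X' Y').
Proof.
  rewrite !card_le_iff; intros (F & HF & F1 & F2) (G & HG & G1 & G2).
  exists (fun p => opair (F (left p)) (G (right p))); split; [dfn|split].
  - intros p Hp; apply in_prod in Hp as (x & y & Hx & Hy & ->).
    rewrite left_opair, right_opair; apply opair_in_prod; auto.
  - intros p q Hp Hq E; apply in_prod in Hp as (x & y & Hx & Hy & ->),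
      Hq as (x' & y' & Hx' & Hy' & ->).
    rewrite !left_opair, !right_opair in E; apply opair_inj in E as [E1 E2].
    f_equal; auto.
Qed.

(** ** Finite ordinals *)

Section Omega.
Variable w : M.
Hypothesis Hw : is_omega w.

Let Ow : ordinal w.
Proof. apply Hw. Qed.
Let Lw : limit_ordinal w.
Proof. apply Hw. Qed.

Lemma below_omega (n : M) : n ∈ w -> n = empty \/ exists j, j ∈ w /\ n = suc j.
Proof.
  intros Hn; assert (On := ord_mem Ow Hn).
  destruct (@not_limit_cases n) as [E|(j & Oj & ->)]; auto.
  - intros L; apply (ord_irrefl Ow), (ord_le_lt_trans Ow (b := n)); auto. apply Hw; auto.
  - right; exists j; split; auto. eapply ord_trans; eauto. apply in_suc; auto.
Qed.

(** If the order type were some [suc j], the element at position [j] would be the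
    largest. *)
Lemma unbounded_card_le (U : M) : subset U w ->
  (forall x, x ∈ w -> exists u, u ∈ U /\ ord_le x u) -> card_le w U.
Proof.
  intros HU H; destruct (otp_le Ow HU) as [K|K].
  - exfalso; destruct (below_omega K) as [E|(j & Hj & E)].
    + destruct Lw as (_ & (x & Hx) & _), (H x Hx) as (u & Hu & _).
      apply (pos_in_otp (B := U)) in Hu. rewrite E in Hu; apply (in_empty _ Hu).
    + assert (J : j ∈ otp U) by (rewrite E; apply in_suc; auto).
      apply in_otp in J as (b & Hb & ->).
      destruct (H (suc b)) as (u & Hu & L); [apply limit_suc; auto|].
      assert (Ob := ord_mem Ow (HU b Hb)); assert (Ou := ord_mem Ow (HU u Hu)).
      assert (B : b ∈ u) by (apply (ord_lt_le_trans Ou (b := suc b)); auto; apply in_suc; auto).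
      assert (P : pos U u ∈ suc (pos U b)) by (rewrite <- E; apply pos_in_otp; auto).
      assert (Q := pos_mono Ow HU Hb Hu B).
      assert (Op := ordinal_pos Ow HU Hb).
      apply (ord_irrefl Op), (ord_lt_le_trans Op Q), in_suc_le, P.
  - rewrite <- K; apply (card_otp_le Ow HU).
Qed.

Lemma omega_split (P : M -> Prop) : Rel1 P ->
  card_le w (sep w P) \/ card_le w (sep w (fun x => ~ P x)).
Proof.
  intros HP; assert (HN : Rel1 (fun x => ~ P x)) by dfn.
  assert (B : forall Q, Rel1 Q -> ~ card_le w (sep w Q) ->
    exists x, x ∈ w /\ forall u, u ∈ w -> Q u -> u ∈ x).
  { intros Q HQ N; apply NNPP; intros K; apply N, unbounded_card_le.
    - intros u Hu; apply in_sep in Hu as []; auto.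
    - intros x Hx; apply NNPP; intros L; apply K; exists x; split; auto.
      intros u Hu Qu; apply ord_not_le; eauto using ord_mem.
      intros xu; apply L; exists u; rewrite in_sep; auto. }
  destruct (classic (card_le w (sep w P))) as [|N1]; auto.
  destruct (classic (card_le w (sep w (fun x => ~ P x)))) as [|N2]; auto.
  exfalso; destruct (B _ HP N1) as (x & Hx & Bx), (B _ HN N2) as (y & Hy & By).
  destruct (ord_max Ow Hx Hy) as (z & Hz & xz & yz).
  assert (Oz := ord_mem Ow Hz); apply (ord_irrefl Oz).
  destruct (classic (P z)) as [Pz|Pz].
  - apply (ord_lt_le_trans Oz (b := x)); auto.
  - apply (ord_lt_le_trans Oz (b := y)); auto.
Qed.

Lemma omega_not_le (n : M) : n ∈ w -> ~ card_le w n.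
Proof.
  intros Hn; refine (ord_induction (P := fun n => n ∈ w -> ~ card_le w n) _ _ (ord_mem Ow Hn) Hn).
  - dfn.
  - clear n Hn; intros n On IH Hn H.
    apply card_le_iff in H as (F & HF & F1 & F2).
    destruct (below_omega Hn) as [-> |(j & Hj & ->)].
    + destruct Lw as (_ & (x & Hx) & _); apply (in_empty _ (F1 x Hx)).
    + assert (HP : Rel1 (fun x => F x ∈ j)) by dfn.
      assert (HN : Rel1 (fun x => ~ F x ∈ j)) by dfn.
      destruct (omega_split HP) as [H|H].
      * apply (IH j); auto; [apply in_suc; auto|].
        apply (card_le_trans H), card_le_iff; exists F; split; auto; split.
        { intros x Hx; apply in_sep in Hx as []; auto. }
        { intros x x' Hx Hx'; apply in_sep in Hx as [], Hx' as []; auto. }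
      * (* [F] is constant on the second part, which is infinite *)
        apply card_le_iff in H as (G & HG & G1 & G2).
        assert (K : forall x, x ∈ w -> F (G x) = j).
        { intros x Hx; assert (L := G1 x Hx); apply in_sep in L as [L N]; auto.
          assert (L' := F1 _ L); apply in_suc in L' as []; tauto. }
        assert (GW : forall x, x ∈ w -> G x ∈ w).
        { intros x Hx; assert (L := G1 x Hx); apply in_sep in L as []; auto. }
        destruct Lw as (_ & (x & Hx) & Lx); destruct (Lx x Hx) as (y & Hy & xy).
        assert (E : x = y) by (apply G2, F2; auto; rewrite !K; auto).
        subst y; apply (ord_irrefl (ord_mem Ow Hx) xy).
Qed.

Lemma omega_not_le_prod (n m : M) : n ∈ w -> m ∈ w -> ~ card_le w (prod n m).
Proof.
  intros Hn Hm; refine (ord_induction (P := fun n => n ∈ w -> ~ card_le w (prod n m)) _ _ (ord_mem Ow Hn) Hn).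
  - dfn.
  - clear n Hn; intros n On IH Hn H.
    apply card_le_iff in H as (F & HF & F1 & F2).
    destruct (below_omega Hn) as [-> |(j & Hj & ->)].
    + destruct Lw as (_ & (x & Hx) & _); specialize (F1 x Hx).
      apply in_prod in F1 as (y & _ & Hy & _); apply (in_empty _ Hy).
    + assert (HP : Rel1 (fun x => left (F x) ∈ j)) by dfn.
      assert (HN : Rel1 (fun x => ~ left (F x) ∈ j)) by dfn.
      destruct (omega_split HP) as [H|H].
      * apply (IH j); auto; [apply in_suc; auto|].
        apply (card_le_trans H), card_le_iff; exists F; split; auto; split.
        { intros x Hx; apply in_sep in Hx as [Hx K]; auto.
          specialize (F1 x Hx); apply in_prod in F1 as (y & z & _ & Hz & E).
          rewrite E, left_opair in *; apply opair_in_prod; auto. }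
        { intros x x' Hx Hx'; apply in_sep in Hx as [], Hx' as []; auto. }
      * apply (omega_not_le Hm), (card_le_trans H), card_le_iff.
        assert (K : forall x, x ∈ sep w (fun x => ~ left (F x) ∈ j) ->
          x ∈ w /\ exists z, z ∈ m /\ F x = opair j z).
        { intros x Hx; apply in_sep in Hx as [Hx N]; auto; split; auto.
          specialize (F1 x Hx); apply in_prod in F1 as (y & z & Hy & Hz & E).
          rewrite E, left_opair in N; exists z; split; auto.
          apply in_suc in Hy as [Hy | ->]; tauto. }
        exists (fun x => right (F x)); split; [dfn|split].
        { intros x Hx; destruct (K x Hx) as (_ & z & Hz & ->).
          rewrite right_opair; auto. }
        { intros x x' Hx Hx' E; destruct (K x Hx) as (W1 & z & Hz & E1),
            (K x' Hx') as (W2 & z' & Hz' & E2).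
          apply F2; auto. rewrite E1, E2 in *; rewrite !right_opair in E; congruence. }
Qed.

End Omega.

Lemma omega_exists (a : M) : limit_ordinal a -> exists w, is_omega w /\ ord_le w a.
Proof.
  intros Ha; destruct (@ord_least M _ limit_ordinal a) as [w Hw]; auto; [dfn|apply Ha|].
  exists w; split; auto. apply Hw; auto; apply Ha.
Qed.

(** An infinite successor [suc j] is in bijection with [j], by shifting [omega]. *)
Lemma infinite_cardinal_limit (k a : M) : cardinal k -> limit_ordinal a -> ord_le a k ->
  limit_ordinal k.
Proof.
  intros Hk La Lak; destruct (omega_exists La) as (w & Hw & Lw).
  assert (Ok : ordinal k) by apply Hk. assert (Oa : ordinal a) by apply La.
  assert (Ow : ordinal w) by apply Hw. assert (LLw : limit_ordinal w) by apply Hw.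
  assert (Lwk := ord_le_trans Ok Lw Lak).
  apply NNPP; intros N; destruct (not_limit_cases Ok N) as [-> |(j & Oj & ->)].
  { destruct LLw as (_ & (x & Hx) & _).
    apply (in_empty x), (ord_lt_le_trans Ok Hx); auto. }
  assert (Lwj : ord_le w j).
  { destruct Lwk as [K|K]; [apply in_suc, K|].
    exfalso; apply N; rewrite <- K; auto. }
  assert (J : j ∈ suc j) by (apply in_suc; auto).
  apply (cardinal_not_le Hk J), card_le_iff.
  set (F := fun x => only (suc j) (fun y =>
    x ∈ w /\ y = suc x \/ x = j /\ y = empty \/ ~ x ∈ w /\ x <> j /\ y = x)).
  assert (HP : forall x, Rel1 (fun y =>
    x ∈ w /\ y = suc x \/ x = j /\ y = empty \/ ~ x ∈ w /\ x <> j /\ y = x)) by (intros; dfn).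
  assert (wj : forall x, x ∈ w -> x <> j).
  { intros x Hx ->; apply (ord_irrefl Oj), (ord_lt_le_trans Oj Hx Lwj). }
  assert (w0 : empty ∈ w).
  { apply ord_not_le; auto using ordinal_empty. intros [H|H]; [apply (in_empty _ H)|].
    destruct LLw as (_ & (x & Hx) & _); rewrite H in Hx; apply (in_empty _ Hx). }
  assert (wj' : forall x, x ∈ w -> x ∈ j) by (intros x Hx; apply (ord_lt_le_trans Oj Hx Lwj)).
  assert (E1 : forall x, x ∈ w -> F x = suc x).
  { intros x Hx; apply only_eq; auto.
    - apply in_suc; left; apply wj', limit_suc; auto.
    - intros y _ [[_ E]|[[E _]|[E _]]]; auto; [destruct (wj x)|]; tauto. }
  assert (E2 : F j = empty).
  { apply only_eq; auto.
    - apply in_suc; left; auto.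
    - intros y _ [[H _]|[[_ E]|(_ & H & _)]]; auto; [destruct (wj j)|]; tauto. }
  assert (E3 : forall x, x ∈ j -> ~ x ∈ w -> F x = x).
  { intros x Hx Nx; assert (x <> j) by (intros ->; apply (ord_irrefl Oj Hx)).
    apply only_eq; auto; [apply in_suc; auto|].
    intros y _ [[H' _]|[[E _]|(_ & _ & E)]]; tauto. }
  assert (C : forall x, x ∈ suc j -> x ∈ w /\ F x = suc x \/ x = j /\ F x = empty \/
    x ∈ j /\ ~ x ∈ w /\ F x = x).
  { intros x Hx; apply in_suc in Hx as [Hx | ->]; auto.
    destruct (classic (x ∈ w)); auto 6. }
  assert (S0 : forall x, x ∈ w -> suc x <> empty).
  { intros x _ E; apply (in_empty x); rewrite <- E; apply in_suc; auto. }
  assert (Sw : forall x, x ∈ w -> suc x ∈ w) by (intros; apply limit_suc; auto).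
  assert (SI : forall x y, x ∈ w -> y ∈ w -> suc x = suc y -> x = y).
  { intros x y Hx Hy E; assert (Ox := ord_mem Ow Hx); assert (Oy := ord_mem Ow Hy).
    apply ord_le_antisym; auto; apply in_suc_le; [rewrite <- E|rewrite E]; apply in_suc; auto. }
  exists F; split; [unfold F, only; dfn|split].
  - intros x Hx; destruct (C x Hx) as [[H ->]|[[_ ->]|(H & _ & ->)]]; auto.
  - intros x y Hx Hy.
    destruct (C x Hx) as [[H ->]|[[-> ->]|(H & H' & ->)]],
      (C y Hy) as [[K ->]|[[-> ->]|(K & K' & ->)]]; auto; intros E; exfalso.
    + apply (S0 x); auto.
    + subst y; auto.
    + apply (S0 y); auto.
    + subst y; auto.
    + subst x; auto.
    + subst x; auto.
Qed.

(** ** Hessenberg's theorem *)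

(** The square of an element of [k] has the size of the square of its
    cardinality, which is a smaller infinite cardinal, or finite. *)
Lemma square_not_above (k m : M) : cardinal k -> limit_ordinal k ->
  (forall n, n ∈ k -> cardinal n -> limit_ordinal n -> card_le (prod n n) n) ->
  m ∈ k -> ~ card_le k (prod m m).
Proof.
  intros Hk Lk IH Hm H; assert (Ok : ordinal k) by apply Hk.
  assert (Om := ord_mem Ok Hm).
  destruct (cardinality_exists Om) as (n & Hn & Lnm & mn & nm).
  assert (On : ordinal n) by apply Hn.
  assert (Hnk : n ∈ k) by (apply (ord_le_lt_trans Ok Lnm Hm)).
  assert (K : card_le k (prod n n)) by (apply (card_le_trans H), card_le_prod; auto).
  destruct (omega_exists Lk) as (w & Hw & Lwk).
  assert (Ow : ordinal w) by apply Hw.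
  destruct (classic (limit_ordinal n)) as [L|L].
  - apply (cardinal_not_le Hk Hnk), (card_le_trans K); auto.
  - assert (Hnw : n ∈ w).
    { apply ord_not_le; auto. intros J; apply L.
      apply (@infinite_cardinal_limit n w); auto. apply Hw. }
    apply (omega_not_le_prod Hw Hnw Hnw), (card_le_trans (Y := k)); auto.
    apply card_le_of_ord_le; auto.
Qed.

(** The union of two ordinals is the larger one. *)
Definition pmax (p : M) : M := cup (left p) (right p).

(** Gödel's well-order of pairs: by the maximum, then lexicographically. *)
Definition godel (p q : M) : Prop :=
  pmax p ∈ pmax q \/ pmax p = pmax q /\
    (left p ∈ left q \/ left p = left q /\ right p ∈ right q).

Lemma cup_ordinal (a b : M) : ordinal a -> ordinal b ->
  (cup a b = a \/ cup a b = b) /\ ord_le a (cup a b) /\ ord_le b (cup a b).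
Proof.
  intros Ha Hb.
  assert (E : cup a b = a \/ cup a b = b).
  { destruct (ord_total Ha Hb) as [H|[H|H]].
    - right; apply set_ext; intros x; rewrite in_cup; split; auto.
      intros [K|K]; auto. eapply ord_trans; eauto.
    - left; subst b; apply set_ext; intros x; rewrite in_cup; tauto.
    - left; apply set_ext; intros x; rewrite in_cup; split; auto.
      intros [K|K]; auto. eapply ord_trans; eauto. }
  assert (O : ordinal (cup a b)) by (destruct E as [-> | ->]; auto).
  split; auto; split; apply ord_le_iff; auto; intros x Hx; apply in_cup; auto.
Qed.

Lemma well_order_godel (k : M) : ordinal k -> well_order (prod k k) godel.
Proof.
  intros Ok.
  assert (O : forall p, p ∈ prod k k -> ordinal (left p) /\ ordinal (right p) /\
    ordinal (pmax p) /\ p = opair (left p) (right p)).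
  { intros p Hp; apply in_prod in Hp as (a & b & Ha & Hb & ->).
    unfold pmax; rewrite left_opair, right_opair.
    assert (Oa := ord_mem Ok Ha); assert (Ob := ord_mem Ok Hb).
    destruct (cup_ordinal Oa Ob) as ([-> | ->] & _); auto. }
  split.
  - dfn.
  - intros p q r Hp Hq Hr.
    destruct (O p Hp) as (P1 & P2 & P3 & _), (O q Hq) as (Q1 & Q2 & Q3 & _),
      (O r Hr) as (R1 & R2 & R3 & _).
    unfold godel; intros [H|[H I]] [K|[K J]]; rewrite ?H, <- ?K; auto.
    + left; eapply ord_trans; eauto.
    + right; split; auto.
      destruct I as [I|[I1 I2]], J as [J|[J1 J2]]; rewrite ?I1, <- ?J1; auto.
      * left; eapply ord_trans; eauto.
      * right; split; auto. eapply ord_trans; eauto.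
  - intros p q Hp Hq.
    destruct (O p Hp) as (P1 & P2 & P3 & P4), (O q Hq) as (Q1 & Q2 & Q3 & Q4).
    unfold godel; destruct (ord_total P3 Q3) as [H|[H|H]]; auto 9.
    destruct (ord_total P1 Q1) as [K|[K|K]]; auto 9.
    destruct (ord_total P2 Q2) as [J|[J|J]]; auto 9.
    right; left; rewrite P4, Q4; f_equal; auto.
  - intros p Hp; destruct (O p Hp) as (P1 & P2 & P3 & _).
    intros [H|[_ [H|[_ H]]]]; eapply ord_irrefl; try exact H; auto.
  - intros P HP (x & Hx & Px).
    (* minimize the larger coordinate, then the first, then the second *)
    destruct (@ord_least M _ (fun a => exists p, p ∈ prod k k /\ P p /\ pmax p = a) (pmax x))
      as (a & Oa & (p & Hp & Pp & <-) & La); [unfold pmax; dfn|apply O; auto|eauto|].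
    destruct (@ord_least M _ (fun b => exists q, q ∈ prod k k /\ P q /\
      pmax q = pmax p /\ left q = b) (left p))
      as (b & Ob & (q & Hq & Pq & E & <-) & Lb); [unfold pmax; dfn|apply O; auto|eauto 6|].
    destruct (@ord_least M _ (fun c => exists r, r ∈ prod k k /\ P r /\
      pmax r = pmax p /\ left r = left q /\ right r = c) (right q))
      as (c & Oc & (r & Hr & Pr & E1 & E2 & <-) & Lc); [unfold pmax; dfn|apply O; auto|eauto 7|].
    exists r; split; auto; split; auto; intros y Hy Py; destruct (O y Hy) as (Y1 & Y2 & Y3 & _).
    unfold godel; rewrite E1, E2; intros [K|[K [J|[J1 J2]]]].
    + revert K; apply ord_not_lt; auto; apply La; eauto.
    + revert J; apply ord_not_lt; auto; apply Lb; eauto 6.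
    + revert J2; apply ord_not_lt; auto; apply Lc; auto.
      exists y; repeat split; congruence.
Qed.

(** In the order [godel] the pairs before [p] lie in the square of an element of [k],
    so the rank of [p] stays below [k]. *)
Theorem hessenberg (k : M) : cardinal k -> limit_ordinal k -> card_le (prod k k) k.
Proof.
  intros Hk Lk.
  refine (ord_induction (P := fun k => cardinal k -> limit_ordinal k -> card_le (prod k k) k)
    _ _ (proj1 Hk) Hk Lk); [dfn|].
  clear k Hk Lk; intros k Ok IH Hk Lk.
  assert (W := well_order_godel Ok); set (X := prod k k) in *.
  assert (HF : Fn (rank X godel)) by (apply Fn_rank; auto).
  assert (HG : Rel2 godel) by apply W.
  enough (L : forall p, p ∈ X -> rank X godel p ∈ k).
  { apply card_le_iff; exists (rank X godel); split; auto; split; auto.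
    intros p q Hp Hq; apply (rank_inj W); auto. }
  intros p Hp; apply ord_not_le; auto; [apply (ordinal_rank W Hp)|]; intros K.
  assert (S : subset k (rank X godel p)) by (apply ord_le_iff; auto; apply (ordinal_rank W Hp)).
  assert (Hm : pmax p ∈ k).
  { unfold X in Hp; apply in_prod in Hp as (a & b & Ha & Hb & ->).
    unfold pmax; rewrite left_opair, right_opair.
    destruct (cup_ordinal (ord_mem Ok Ha) (ord_mem Ok Hb)) as ([-> | ->] & _); auto. }
  assert (Om := ord_mem Ok Hm).
  apply (@square_not_above k (suc (pmax p))); auto; [apply limit_suc; auto|].
  assert (HP : forall x, Rel1 (fun q => rank X godel q = x)) by (intros; dfn).
  assert (Q : forall x, x ∈ k -> exists q, q ∈ X /\ godel q p /\ rank X godel q = x /\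
    only X (fun q => rank X godel q = x) = q).
  { intros x Hx; destruct (rank_initial W Hp (S x Hx)) as (q & Hq & G & <-).
    exists q; split; auto; split; auto; split; auto. apply only_eq; auto.
    intros q' Hq'; apply (rank_inj W); auto. }
  apply card_le_iff; exists (fun x => only X (fun q => rank X godel q = x)).
  split; [unfold only; dfn|split].
  - intros x Hx; destruct (Q x Hx) as (q & Hq & G & _ & ->).
    unfold X in Hq; apply in_prod in Hq as (a & b & Ha & Hb & ->).
    assert (Oa := ord_mem Ok Ha); assert (Ob := ord_mem Ok Hb).
    destruct (cup_ordinal Oa Ob) as (E & L1 & L2).
    assert (B : ord_le (cup a b) (pmax p)).
    { unfold godel in G; unfold pmax at 1 3 in G; rewrite left_opair, right_opair in G.
      destruct G as [G|[G _]]; [left|right]; auto. }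
    apply opair_in_prod; rewrite !in_suc_le; split; eapply ord_le_trans; eauto.
  - intros x y Hx Hy; destruct (Q x Hx) as (q & _ & _ & <- & ->),
      (Q y Hy) as (r & _ & _ & <- & ->); congruence.
Qed.

Corollary cardinal_not_le_prod (k a b : M) : cardinal k -> limit_ordinal k ->
  a ∈ k -> b ∈ k -> ~ card_le k (prod a b).
Proof.
  intros Hk Lk Ha Hb H; assert (Ok : ordinal k) by apply Hk.
  destruct (ord_max Ok Ha Hb) as (c & Hc & ac & bc).
  assert (Oc := ord_mem Ok Hc).
  apply (@square_not_above k c); auto using hessenberg.
  apply (card_le_trans H), card_le_subset, subset_prod; apply ord_le_iff; eauto using ord_mem.
Qed.

Lemma prod_below_cardinal (k a b : M) : cardinal k -> limit_ordinal k ->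
  a ∈ k -> b ∈ k -> exists n, n ∈ k /\ card_le (prod a b) n.
Proof.
  intros Hk Lk Ha Hb; assert (Ok : ordinal k) by apply Hk.
  destruct (@equipotent_ordinal (prod a b) k) as (n & On & L & E); auto.
  - apply (card_le_trans (Y := prod k k)); [|apply hessenberg; auto].
    apply card_le_subset, subset_prod; intros x Hx; [apply (ord_trans Ok Ha Hx)|].
    apply (ord_trans Ok Hb Hx).
  - apply equipotent_le in E as [nP Pn]; exists n; split; auto.
    destruct L as [L| ->]; auto. destruct (cardinal_not_le_prod Hk Lk Ha Hb nP).
Qed.

(** An element of a union is located by a member of the family that contains it
    and by its position there. *)
Lemma card_le_family (Y sel : M -> M) (B A t r : M) : Fn Y -> Fn sel -> ordinal t -> ordinal r ->
  (forall y, y ∈ B -> sel y ∈ A /\ y ∈ Y (sel y)) ->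
  (forall i, i ∈ A -> subset (Y i) t /\ ord_le (otp (Y i)) r) -> card_le B (prod A r).
Proof.
  intros HY Hsel Ot Or L H.
  apply card_le_iff; exists (fun y => opair (sel y) (pos (Y (sel y)) y)).
  split; [dfn|split].
  - intros y Hy; destruct (L y Hy) as [Hi Hyi].
    destruct (H _ Hi) as [S1 S2]; apply opair_in_prod; split; auto.
    apply (ord_lt_le_trans Or (pos_in_otp Hyi) S2).
  - intros y z Hy Hz E; destruct (L y Hy) as [Hi Hyi], (L z Hz) as [Hj Hzj].
    apply opair_inj in E as [E1 E2]; rewrite <- E1 in *.
    destruct (H _ Hi) as [S1 _]; apply (pos_inj Ot S1) in E2; auto.
Qed.

End Cardinals.

(** * Hartogs numbers, Lindenbaum numbers, successors *)

Section Numbers.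
Context {M : set_structure} {hM : ZF M}.

Lemma ordinal_lst (P : M -> Prop) : Rel1 P -> ordinal (lst P).
Proof.
  intros HP; destruct (classic (exists a, ordinal a /\ P a)) as [(a & Oa & Pa)|N].
  - apply (lst_least HP Oa Pa).
  - replace (lst P) with (empty (M := M)); [apply ordinal_empty|].
    apply set_ext; intros x; unfold lst; rewrite (in_setof _ (lst_exists HP) x).
    split; [intros H; destruct (in_empty _ H)|tauto].
Qed.

(** A partial surjection from [X] onto [a] is replaced by the preorder that it induces
    on its domain, a subset of [prod X X] that determines [a]. Hence the ordinals onto
    which [X] maps form a set. *)
Definition codes (X r a : M) : Prop := exists f,
  (forall b, b ∈ a -> exists x, x ∈ X /\ app f x = b) /\
  forall x y, x ∈ X -> y ∈ X -> (opair x y ∈ r <->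
    app f x ∈ a /\ app f y ∈ a /\ ord_le (app f x) (app f y)).

Lemma codes_subset (X r a b : M) : ordinal a -> ordinal b ->
  codes X r a -> codes X r b -> subset a b.
Proof.
  intros Oa Ob (f & Sf & Hf) (g & Sg & Hg).
  assert (L : forall x y, x ∈ X -> y ∈ X -> app f x ∈ a -> app f y ∈ a ->
    (app f y ∈ app f x <-> app g y ∈ app g x) /\ app g x ∈ b).
  { intros x y Hx Hy Fx Fy.
    assert (Gx : app g x ∈ b).
    { assert (K : opair x x ∈ r) by (apply Hf; auto using ord_le_refl).
      apply Hg in K; tauto. }
    assert (Gy : app g y ∈ b).
    { assert (K : opair y y ∈ r) by (apply Hf; auto using ord_le_refl).
      apply Hg in K; tauto. }
    split; auto.
    rewrite <- (ord_not_le (a := app f x) (b := app f y)), <- (ord_not_le (a := app g x) (b := app g y))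
      by eauto using ord_mem.
    specialize (Hf x y Hx Hy); specialize (Hg x y Hx Hy); tauto. }
  assert (E : forall c, ordinal c -> c ∈ a -> forall x, x ∈ X -> app f x = c -> app g x = c).
  { apply (ord_induction (P := fun c => c ∈ a -> forall x, x ∈ X -> app f x = c -> app g x = c)).
    { dfn. }
    intros c Oc IH Hc x Hx Fx; subst c; apply set_ext; intros z; split; intros Hz.
    - destruct (L x x) as [_ Gx]; auto.
      destruct (Sg z) as (y & Hy & <-); [apply (ord_trans Ob Gx Hz)|].
      assert (Fy : app f y ∈ a).
      { assert (K : opair y y ∈ r).
        { apply Hg; auto; assert (app g y ∈ b) by apply (ord_trans Ob Gx Hz); auto using ord_le_refl. }
        apply Hf in K; tauto. }
      assert (K : app f y ∈ app f x) by (apply (L x y); auto).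
      rewrite (IH (app f y)); auto.
    - assert (Za := ord_trans Oa Hc Hz); destruct (Sf z Za) as (y & Hy & <-).
      rewrite <- (IH (app f y)) with (x := y) at 1; auto.
      apply (L x y); auto. }
  intros c Hc; destruct (Sf c Hc) as (x & Hx & <-).
  rewrite <- (E (app f x)) with (x := x) at 1; eauto using ord_mem.
  apply (L x x); auto.
Qed.

Theorem lindenbaum_exists (X : M) : exists l, is_lindenbaum X l.
Proof.
  destruct (zf_powerset hM (prod X X)) as [p Hp].
  assert (HC : forall r, Rel1 (codes X r)) by (intros; dfn).
  assert (HF : Fn (fun r => lst (codes X r))) by dfn.
  set (A := repl p (fun r => lst (codes X r))).
  assert (OA : forall a, a ∈ A -> ordinal a).
  { intros a Ha; apply (in_repl _ _ HF) in Ha as (r & _ & ->); apply ordinal_lst; auto. }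
  assert (Ob := ordinal_suc (ordinal_bigcup OA)).
  set (b := suc (bigcup A)) in *.
  apply (@ord_least M _ (fun b => ~ card_le_star b X) b); [dfn|auto|]; intros H.
  apply card_le_star_iff in H as (F & HFF & HS).
  assert (HR : Rel1 (fun q => F (left q) ∈ b /\ F (right q) ∈ b /\
    ord_le (F (left q)) (F (right q)))) by dfn.
  set (r := sep (prod X X) (fun q => F (left q) ∈ b /\ F (right q) ∈ b /\
    ord_le (F (left q)) (F (right q)))).
  assert (K : codes X r b).
  { exists (lam X F); split.
    - intros c Hc; destruct (HS c Hc) as (x & Hx & E); exists x; rewrite app_lam; auto.
    - intros x y Hx Hy; rewrite !app_lam by auto; unfold r.
      rewrite in_sep, opair_in_prod, left_opair, right_opair; tauto. }
  assert (E : lst (codes X r) = b).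
  { apply lst_eq; auto; split; auto; split; auto.
    intros c Oc Kc; apply ord_le_iff; auto; apply (codes_subset Ob Oc K Kc). }
  assert (BA : b ∈ A).
  { apply (in_repl _ _ HF); exists r; split; auto.
    apply Hp; intros q Hq; apply in_sep in Hq as []; auto. }
  apply (ord_irrefl Ob), (ord_le_lt_trans Ob (bigcup_upper OA BA)), in_suc; auto.
Qed.

Lemma in_lindenbaum (X l b : M) : is_lindenbaum X l -> ordinal b ->
  (b ∈ l <-> card_le_star b X).
Proof.
  intros (Ol & Nl & Ll) Ob; split.
  - intros Hb; apply NNPP; intros N; apply (ord_irrefl Ob), (ord_lt_le_trans Ob Hb), Ll; auto.
  - intros H; apply ord_not_le; auto; intros K; apply Nl.
    apply (card_le_star_trans (Y := b)); auto.
    apply card_le_star_of_le, card_le_of_ord_le; auto.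
Qed.

Lemma in_hartogs (X h b : M) : is_hartogs X h -> ordinal b -> (b ∈ h <-> card_le b X).
Proof.
  intros (Oh & Nh & Lh) Ob; split.
  - intros Hb; apply NNPP; intros N; apply (ord_irrefl Ob), (ord_lt_le_trans Ob Hb), Lh; auto.
  - intros H; apply ord_not_le; auto; intros K; apply Nh.
    apply (card_le_trans (Y := b)); auto. apply card_le_of_ord_le; auto.
Qed.

Lemma cardinal_lindenbaum (X l : M) : is_lindenbaum X l -> cardinal l.
Proof.
  intros Hl; assert (Ol : ordinal l) by apply Hl; apply cardinal_intro; auto.
  intros b Hb H; assert (Ob := ord_mem Ol Hb).
  apply (ord_irrefl Ol), (in_lindenbaum Hl Ol), (card_le_star_trans (Y := b)).
  - apply card_le_star_of_le, H.
  - apply (in_lindenbaum Hl Ob), Hb.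
Qed.

Lemma cardinal_hartogs (X h : M) : is_hartogs X h -> cardinal h.
Proof.
  intros Hh; assert (Oh : ordinal h) by apply Hh; apply cardinal_intro; auto.
  intros b Hb H; assert (Ob := ord_mem Oh Hb).
  apply (ord_irrefl Oh), (in_hartogs Hh Oh), (card_le_trans H), (in_hartogs Hh Ob), Hb.
Qed.

Lemma succ_cardinal_exists (k : M) : ordinal k -> exists s, is_succ_cardinal k s.
Proof.
  intros Ok; destruct (lindenbaum_exists k) as [l Hl].
  apply (@ord_least M _ (fun b => cardinal b /\ k ∈ b) l); [dfn|apply Hl|split].
  - apply (cardinal_lindenbaum Hl).
  - apply (in_lindenbaum Hl Ok), card_le_star_of_le, card_le_subset; intros x; auto.
Qed.

Lemma below_succ_cardinal (k s b : M) : cardinal k -> is_succ_cardinal k s -> b ∈ s ->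
  card_le b k.
Proof.
  intros Hk (Os & _ & Ls) Hb; assert (Ok : ordinal k) by apply Hk.
  assert (Ob := ord_mem Os Hb).
  destruct (cardinality_exists Ob) as (n & Hn & Lnb & bn & _).
  assert (On : ordinal n) by apply Hn.
  apply (card_le_trans bn), card_le_of_ord_le; auto.
  apply ord_not_lt; auto; intros H.
  apply (ord_irrefl Os), (ord_le_lt_trans Os (b := n)).
  - apply Ls; auto.
  - apply (ord_le_lt_trans Os Lnb Hb).
Qed.

(** Suppose [h] is [suc a] and embed [a] into [X]. If a point is missed, [suc a]
    embeds as well; otherwise [a] maps onto [X], hence onto [h], although [h] is a
    cardinal. *)
Lemma hartogs_limit (X h l : M) : is_hartogs X h -> is_lindenbaum X l -> h ∈ l ->
  limit_ordinal h.
Proof.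
  intros Hh Hl hl; assert (Oh : ordinal h) by apply Hh; assert (Ch := cardinal_hartogs Hh).
  apply NNPP; intros N; destruct (not_limit_cases Oh N) as [-> |(a & Oa & ->)].
  - apply (ord_irrefl Oh), (in_hartogs Hh Oh), card_le_subset.
    intros x Hx; destruct (in_empty _ Hx).
  - assert (Ha : a ∈ suc a) by (apply in_suc; auto).
    assert (I : card_le a X) by (apply (in_hartogs Hh Oa); auto).
    apply card_le_iff in I as (F & HF & F1 & F2).
    destruct (classic (exists x, x ∈ X /\ forall b, b ∈ a -> F b <> x)) as [(x & Hx & Nx)|K].
    + apply (ord_irrefl Oh), (in_hartogs Hh Oh), card_le_iff.
      set (G := fun b => only X (fun y => b ∈ a /\ y = F b \/ b = a /\ y = x)).
      assert (HP : forall b, Rel1 (fun y => b ∈ a /\ y = F b \/ b = a /\ y = x))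
        by (intros; dfn).
      assert (Na : ~ a ∈ a) by (apply ord_irrefl; auto).
      assert (C : forall b, b ∈ suc a -> b ∈ a /\ G b = F b \/ b = a /\ G b = x).
      { intros b Hb; apply in_suc in Hb as [Hb | ->].
        - left; split; auto; apply only_eq; auto.
          intros y _ [[_ E]|[E _]]; auto. subst; tauto.
        - right; split; auto; apply only_eq; auto.
          intros y _ [[E _]|[_ E]]; auto. tauto. }
      exists G; split; [unfold G, only; dfn|split].
      * intros b Hb; destruct (C b Hb) as [[H ->]|[_ ->]]; auto.
      * intros b c Hb Hc; destruct (C b Hb) as [[H ->]|[-> ->]], (C c Hc) as [[H' ->]|[-> ->]]; auto.
        { intros E; destruct (Nx b); auto. }
        { intros E; destruct (Nx c); auto. }
    + apply (cardinal_not_le Ch Ha), card_le_star_ordinal; auto.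
      apply (card_le_star_trans (Y := X)); [apply (in_lindenbaum Hl Oh), hl|].
      apply card_le_star_iff; exists F; split; auto.
      intros x Hx; apply NNPP; intros L; apply K; exists x; split; auto.
      intros b Hb E; apply L; eauto.
Qed.

End Numbers.

(** * Cofinality *)

Section Cofinality.
Context {M : set_structure} {hM : ZF M}.

Lemma cofinal_map_iff (b a : M) : (exists f, is_cofinal_map f b a) <-> exists F, Fn F /\
  (forall d, d ∈ b -> F d ∈ a) /\ (forall x, x ∈ a -> exists d, d ∈ b /\ ord_le x (F d)).
Proof.
  split.
  - intros (f & Hf & H); exists (app f); split; [dfn|split].
    + intros d Hd; apply (maps_app Hf Hd).
    + intros x Hx; destruct (H x Hx) as (d & y & Hd & L); exists d.
      assert (Db : d ∈ b).
      { apply maps_opair in Hd; destruct (proj1 Hf _ Hd) as (d' & y' & Hd' & _ & K).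
        apply is_opair_eq, opair_inj in K as [-> _]; auto. }
      split; auto. apply (maps_app Hf Db) in Hd as ->; auto.
  - intros (F & HF & F1 & F2); exists (lam b F); split; [apply is_function_lam; auto|].
    intros x Hx; destruct (F2 x Hx) as (d & Hd & L); exists d, (F d); split; auto.
    apply maps_lam; auto.
Qed.

Lemma cofinality_exists (a : M) : ordinal a -> exists c, is_cofinality a c.
Proof.
  intros Oa; apply (@ord_least M _ (fun b => exists f, is_cofinal_map f b a) a); auto.
  - dfn.
  - apply cofinal_map_iff; exists (fun x => x); split; [dfn|split]; auto.
    intros x Hx; exists x; auto using ord_le_refl.
Qed.

(** Cofinality arguments produce maps with stray values outside [a]; they are sent to
    a fixed element. *)
Lemma totalize (F : M -> M) (a : M) : Fn F -> (exists x, x ∈ a) ->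
  exists G, Fn G /\ (forall d, G d ∈ a) /\ forall d, F d ∈ a -> G d = F d.
Proof.
  intros HF [x0 H0].
  set (G := fun d => only a (fun x => x = F d \/ ~ F d ∈ a /\ x = x0)).
  assert (HP : forall d, Rel1 (fun x => x = F d \/ ~ F d ∈ a /\ x = x0)) by (intros; dfn).
  assert (E : forall d, F d ∈ a -> G d = F d).
  { intros d Hd; apply only_eq; auto. intros y _ [|[]]; tauto. }
  exists G; split; [unfold G, only; dfn|split; auto].
  intros d; destruct (classic (F d ∈ a)) as [K|K]; [rewrite E; auto|].
  replace (G d) with x0; auto; symmetry; apply only_eq; auto.
  intros y Hy [->|[_ ?]]; tauto.
Qed.

Lemma cofinality_min (a c b : M) (F : M -> M) : is_cofinality a c -> ordinal b -> Fn F ->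
  (exists x, x ∈ a) ->
  (forall x, x ∈ a -> exists d, d ∈ b /\ F d ∈ a /\ ord_le x (F d)) -> ord_le c b.
Proof.
  intros (_ & _ & L) Ob HF Na H; apply L; auto.
  destruct (totalize HF Na) as (G & HG & G1 & G2).
  apply cofinal_map_iff; exists G; split; auto; split; auto.
  intros x Hx; destruct (H x Hx) as (d & Hd & Fd & Ld); exists d; rewrite G2; auto.
Qed.

Lemma below_cofinality (a c b : M) (F : M -> M) : ordinal a -> is_cofinality a c ->
  b ∈ c -> Fn F -> (forall d, d ∈ b -> F d ∈ a) ->
  exists x, x ∈ a /\ forall d, d ∈ b -> F d ∈ x.
Proof.
  intros Oa Hc Hb HF F1; assert (Oc : ordinal c) by apply Hc.
  assert (Ob := ord_mem Oc Hb).
  apply NNPP; intros N; apply (ord_irrefl Oc).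
  apply (ord_le_lt_trans Oc (b := b)); auto.
  destruct (classic (exists x, x ∈ a)) as [Na|Na].
  - apply (cofinality_min Hc Ob HF); auto.
    intros x Hx; apply NNPP; intros K; apply N; exists x; split; auto.
    intros d Hd; apply ord_not_le; [apply (ord_mem Oa Hx)|apply (ord_mem Oa), F1, Hd|].
    intros L; apply K; exists d; auto.
  - apply Hc; auto. apply cofinal_map_iff; exists F; split; auto; split; auto.
    intros x Hx; destruct Na; eauto.
Qed.

(** If [c] were [suc j], dropping [j] would leave a bounded map, and the single value
    at [j] does not reach the end of [a]. *)
Lemma cofinality_limit (a c : M) : limit_ordinal a -> is_cofinality a c -> limit_ordinal c.
Proof.
  intros La Hc; assert (Oc : ordinal c) by apply Hc; assert (Oa : ordinal a) by apply La.
  destruct Hc as (_ & Hf & Lc); assert (Hc : is_cofinality a c) by (split; auto).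
  apply cofinal_map_iff in Hf as (F & HF & F1 & F2).
  apply NNPP; intros N; destruct (not_limit_cases Oc N) as [-> |(j & Oj & ->)].
  - destruct La as (_ & (x & Hx) & _), (F2 x Hx) as (d & Hd & _); apply (in_empty _ Hd).
  - assert (J : j ∈ suc j) by (apply in_suc; auto).
    destruct (below_cofinality (F := F) Oa Hc J) as (x & Hx & Bx); auto.
    { intros d Hd; apply F1, in_suc; auto. }
    destruct (ord_max Oa Hx (F1 j J)) as (y & Hy & xy & jy).
    assert (Oy := ord_mem Oa Hy).
    destruct (F2 (suc y)) as (d & Hd & L); [apply limit_suc; auto|].
    assert (Od := ord_mem Oa (F1 d Hd)).
    assert (K : y ∈ F d) by (apply (ord_lt_le_trans (b := suc y)); auto; apply in_suc; auto).
    apply (ord_irrefl Oy); apply in_suc in Hd as [Hd | ->].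
    + apply (ord_lt_le_trans (b := x)); auto. apply (ord_trans (ord_mem Oa Hx) (Bx d Hd) K).
    + apply (ord_lt_le_trans Oy K); auto.
Qed.

(** A cofinal map from [b] to [c] need not compose with one from [c] to [a]; the
    composite with the suprema of the latter over initial segments is cofinal. *)
Lemma cofinality_of_cofinality (a c b : M) (G : M -> M) : limit_ordinal a ->
  is_cofinality a c -> ordinal b -> Fn G ->
  (forall x, x ∈ c -> exists d, d ∈ b /\ G d ∈ c /\ ord_le x (G d)) -> ord_le c b.
Proof.
  intros La Hc Ob HG G2; assert (Oa : ordinal a) by apply La.
  assert (Lc := cofinality_limit La Hc); assert (Oc : ordinal c) by apply Hc.
  pose proof Hc as (_ & Hf & _); apply cofinal_map_iff in Hf as (F & HF & F1 & F2).
  set (Q := fun i x => x ∈ a /\ forall d, d ∈ suc i -> F d ∈ x).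
  assert (HQ : Rel2 Q) by dfn.
  assert (K : forall i, i ∈ c -> is_least_ordinal (Q i) (lst (Q i))).
  { intros i Hi.
    destruct (below_cofinality (b := suc i) (F := F) Oa Hc) as (x & Hx & Bx); auto.
    - apply limit_suc; auto.
    - intros d Hd; apply F1, (ord_le_lt_trans (b := i)); auto. apply in_suc_le, Hd.
    - apply (@lst_least M _ _ x); [dfn|apply (ord_mem Oa Hx)|split; auto]. }
  apply (cofinality_min (F := fun d => lst (Q (G d))) Hc Ob); [dfn|apply La|].
  intros x Hx; destruct (F2 x Hx) as (i & Hi & Li), (G2 i Hi) as (d & Hd & Gd & Ld).
  exists d; split; auto; destruct (K (G d) Gd) as (OQ & [Qa QF] & _); split; auto.
  apply (ord_le_trans OQ Li); left; apply QF, in_suc_le, Ld.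
Qed.

Theorem cofinality_regular (a c : M) : limit_ordinal a -> is_cofinality a c ->
  regular_cardinal c.
Proof.
  intros La Hc; assert (Lc := cofinality_limit La Hc); assert (Oc : ordinal c) by apply Hc.
  split; [|split].
  - apply cardinal_intro; auto; intros b Hb H; assert (Ob := ord_mem Oc Hb).
    apply card_le_star_of_le, card_le_star_iff in H as (G & HG & G2).
    apply (ord_irrefl Oc), (ord_le_lt_trans (b := b)); auto.
    apply (cofinality_of_cofinality (G := G) La Hc Ob); auto.
    intros x Hx; destruct (G2 x Hx) as (d & Hd & <-); exists d; auto using ord_le_refl.
  - destruct (omega_exists Lc) as (w & Hw & L); exists w; auto.
  - split; auto; split.
    + apply cofinal_map_iff; exists (fun x => x); split; [dfn|split]; auto.
      intros x Hx; exists x; auto using ord_le_refl.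
    + intros b Ob Hb; apply cofinal_map_iff in Hb as (G & HG & G1 & G2).
      apply (cofinality_of_cofinality La Hc Ob HG).
      intros x Hx; destruct (G2 x Hx) as (d & Hd & L); exists d; auto.
Qed.

End Cofinality.

(** * Sets lying thinly over a limit ordinal *)

Section Thin.
Context {M : set_structure} {hM : ZF M}.

Definition well_orderable (A : M) : Prop := exists n g, ordinal n /\
  forall a, a ∈ A -> exists b, b ∈ n /\ a = app g b.

(** The failure of choice behind a gap: no well-ordered choice of elements of [Z] can
    follow the ascent of [Z] in [k]. *)
Definition thinly_cofinal (k Z R : M) : Prop :=
  (forall x, x ∈ k -> exists z j, z ∈ Z /\ j ∈ k /\ opair z j ∈ R /\ ord_le x j) /\
  (forall A, subset A Z -> well_orderable A ->
    exists x, x ∈ k /\ forall z j, z ∈ A -> j ∈ k -> opair z j ∈ R -> ord_le j x).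

Lemma well_orderable_repl (F : M -> M) (n : M) : Fn F -> ordinal n ->
  well_orderable (repl n F).
Proof.
  intros HF On; exists n, (lam n F); split; auto.
  intros a Ha; apply (in_repl _ _ HF) in Ha as (b & Hb & ->); exists b.
  rewrite app_lam; auto.
Qed.

Lemma well_orderable_subset (A B : M) : subset A B -> well_orderable B -> well_orderable A.
Proof. intros H (n & g & On & Hg); exists n, g; auto. Qed.

Lemma well_orderable_equipotent (A : M) : well_orderable A ->
  exists r, ordinal r /\ equipotent r A.
Proof.
  intros (n & g & On & Hg); destruct (@equipotent_ordinal _ _ A n) as (r & Or & _ & E); eauto.
  apply card_le_star_ordinal; auto; apply card_le_star_iff; exists (app g); split; [dfn|].
  intros a Ha; destruct (Hg a Ha) as (b & Hb & ->); eauto.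
Qed.

(** With [mu] cofinal from [c] to [k], an element over [x] in [k] is put over all [i]
    in [c] such that [mu] stays below [x] before [i]. *)
Lemma thinly_cofinal_cofinality (k c Z R : M) : limit_ordinal k -> is_cofinality k c ->
  thinly_cofinal k Z R -> exists R', thinly_cofinal c Z R'.
Proof.
  intros Lk Hc [H1 H2]; assert (Ok : ordinal k) by apply Lk; assert (Oc : ordinal c) by apply Hc.
  pose proof Hc as (_ & Hf & _); apply cofinal_map_iff in Hf as (mu & Hmu & mu1 & mu2).
  set (Q := fun q => exists x, x ∈ k /\ opair (left q) x ∈ R /\
    forall i, i ∈ right q -> mu i ∈ x).
  assert (HQ : Rel1 Q) by dfn.
  assert (HR : forall z i, opair z i ∈ sep (prod Z c) Q <->
    z ∈ Z /\ i ∈ c /\ exists x, x ∈ k /\ opair z x ∈ R /\ forall i', i' ∈ i -> mu i' ∈ x).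
  { intros z i; rewrite in_sep by auto; unfold Q; rewrite left_opair, right_opair, opair_in_prod.
    tauto. }
  exists (sep (prod Z c) Q); split.
  - intros i Hi.
    destruct (below_cofinality (F := mu) Ok Hc Hi) as (x & Hx & Bx); auto.
    { intros d Hd; apply mu1, (ord_trans Oc Hi Hd). }
    destruct (H1 x Hx) as (z & j & Hz & Hj & HR' & L).
    exists z, i; split; auto; split; auto; split; [|apply ord_le_refl].
    apply HR; split; auto; split; auto; exists j; split; auto; split; auto.
    intros i' Hi'; apply (ord_lt_le_trans (ord_mem Ok Hj) (Bx i' Hi') L).
  - intros A HA W; destruct (H2 A HA W) as (x & Hx & Bx).
    destruct (mu2 x Hx) as (i & Hi & Li); exists i; split; auto.
    intros z j Hz Hj K; apply HR in K as (_ & _ & y & Hy & Ry & By).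
    apply ord_not_lt; eauto using ord_mem; intros ij.
    assert (Oi := ord_mem Ok (mu1 i Hi)); assert (Oy := ord_mem Ok Hy).
    apply (ord_irrefl Oi), (ord_lt_le_trans (b := y)); auto.
    apply (ord_le_trans (b := x)); auto. apply (Bx z); auto.
Qed.

(** A well-orderable subset of [X] has size below [h], so a surjection from [X] onto
    the regular [h] is bounded on it. *)
Lemma thinly_cofinal_regular (X h l : M) : is_hartogs X h -> is_lindenbaum X l -> h ∈ l ->
  is_cofinality h h -> exists Z R, thinly_cofinal h Z R.
Proof.
  intros Hh Hl hl Hc; assert (Oh : ordinal h) by apply Hh.
  assert (Lh := hartogs_limit Hh Hl hl).
  apply (in_lindenbaum Hl Oh), card_le_star_iff in hl as (G & HG & SG).
  assert (HP : Rel1 (fun q => right q = G (left q))) by dfn.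
  exists X, (sep (prod X h) (fun q => right q = G (left q))).
  assert (HR : forall x j, opair x j ∈ sep (prod X h) (fun q => right q = G (left q)) <->
    x ∈ X /\ j ∈ h /\ j = G x).
  { intros x j; rewrite in_sep, left_opair, right_opair, opair_in_prod by auto; tauto. }
  split.
  - intros b Hb; destruct (SG b Hb) as (x & Hx & E); exists x, b.
    split; auto; split; auto; split; [apply HR; auto|apply ord_le_refl].
  - intros A HA W; destruct (well_orderable_equipotent W) as (r & Or & E).
    apply equipotent_le in E as [rA Ar].
    assert (Hr : r ∈ h).
    { apply (in_hartogs Hh Or), (card_le_trans rA), card_le_subset; auto. }
    apply card_le_star_of_le, card_le_star_iff in Ar as (E & HE & SE).
    apply NNPP; intros N; apply (ord_irrefl Oh), (ord_le_lt_trans Oh (b := r)); auto.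
    apply (cofinality_min (F := fun d => G (E d)) Hc Or); [dfn|apply Lh|].
    intros x Hx; apply NNPP; intros K; apply N; exists x; split; auto.
    intros z j Hz Hj Rz; apply HR in Rz as (_ & _ & ->).
    apply ord_not_lt; eauto using ord_mem; intros L; apply K.
    destruct (SE z Hz) as (d & Hd & <-); exists d; split; auto; split; auto; left; auto.
Qed.

(** [Z] contains the injections into [X], each put over its domain. A well-ordered
    family of injections of unboundedly many elements of [h] into [X] has a
    well-orderable union of ranges, of size [r] in [h]; it then presents [h] as a union
    of [c] sets of size at most [r]. *)
Lemma thinly_cofinal_singular (X h c : M) : is_hartogs X h -> limit_ordinal h ->
  is_cofinality h c -> c ∈ h -> exists Z R, thinly_cofinal h Z R.
Proof.
  intros Hh Lh Hc Hch; assert (Oh : ordinal h) by apply Hh; assert (Oc : ordinal c) by apply Hc.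
  assert (Ch := cardinal_hartogs Hh).
  destruct (zf_powerset hM (prod h X)) as [p Hp].
  set (I := fun f a => forall x, x ∈ a -> app f x ∈ X /\
    forall y, y ∈ a -> app f x = app f y -> x = y).
  assert (HI : Rel2 I) by dfn.
  assert (HP : Rel1 (fun q => I (left q) (right q))) by dfn.
  set (R := sep (prod p h) (fun q => I (left q) (right q))).
  assert (HR : forall f a, opair f a ∈ R <-> f ∈ p /\ a ∈ h /\ I f a).
  { intros f a; unfold R; rewrite in_sep, left_opair, right_opair, opair_in_prod by auto; tauto. }
  exists p, R; split.
  - intros a Ha; assert (Oa := ord_mem Oh Ha).
    destruct (proj1 (card_le_iff _ _) (proj1 (in_hartogs Hh Oa) Ha)) as (F & HF & F1 & F2).
    exists (lam a F), a; split; [|split; [auto|split; [|apply ord_le_refl]]].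
    + apply Hp; intros q Hq; apply in_lam in Hq as (x & Hx & ->); auto.
      apply opair_in_prod; split; auto. apply (ord_trans Oh Ha Hx).
    + apply HR; split; [|split; auto].
      * apply Hp; intros q Hq; apply in_lam in Hq as (x & Hx & ->); auto.
        apply opair_in_prod; split; auto. apply (ord_trans Oh Ha Hx).
      * intros x Hx; rewrite app_lam by auto; split; auto.
        intros y Hy; rewrite app_lam by auto; auto.
  - intros A HA (n & g & On & Hg); apply NNPP; intros N.
    pose proof Hc as (_ & Hf & _); apply cofinal_map_iff in Hf as (mu & Hmu & mu1 & mu2).
    set (b := fun i => lst (fun b => b ∈ n /\ I (app g b) (mu i))).
    assert (Fb : Fn b) by dfn.
    assert (Hb : forall i, i ∈ c -> I (app g (b i)) (mu i)).
    { intros i Hi; assert (Hmi := mu1 i Hi).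
      assert (K : exists b, b ∈ n /\ I (app g b) (mu i)).
      { apply NNPP; intros K; apply N; exists (mu i); split; auto.
        intros z j Hz Hj Rz; apply ord_not_lt; eauto using ord_mem; intros L; apply K.
        destruct (Hg z Hz) as (b' & Hb' & ->); exists b'; split; auto.
        apply HR in Rz as (_ & _ & Iz).
        assert (T : forall x, x ∈ mu i -> x ∈ j).
        { intros x Hx; apply (ord_trans (ord_mem Oh Hj) L Hx). }
        intros x Hx; split; [apply Iz; auto|]. intros y Hy; apply Iz; auto. }
      destruct K as (b' & Hb' & K).
      apply (@lst_least M _ (fun b => b ∈ n /\ I (app g b) (mu i)) b'); auto; [dfn|].
      apply (ord_mem On Hb'). }
    (* [U] enumerates the union of the ranges along a part of [prod c h] *)
    set (U := fun q => app (app g (b (left q))) (right q)).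
    assert (FU : Fn U) by dfn.
    assert (HQ : Rel1 (fun q => right q ∈ mu (left q))) by dfn.
    set (D := sep (prod c h) (fun q => right q ∈ mu (left q))).
    assert (HD : forall i x, i ∈ c -> x ∈ mu i -> opair i x ∈ D).
    { intros i x Hi Hx; apply in_sep; auto; rewrite left_opair, right_opair, opair_in_prod.
      split; auto; split; auto. apply (ord_trans Oh (mu1 i Hi) Hx). }
    assert (UX : subset (repl D U) X).
    { intros y Hy; apply (in_repl _ _ FU) in Hy as (q & Hq & ->).
      apply in_sep in Hq as [Hq K]; auto.
      apply in_prod in Hq as (i & x & Hi & Hx & ->); unfold U.
      rewrite left_opair, right_opair in *; apply (Hb i); auto. }
    destruct (@equipotent_ordinal _ _ (repl D U) h) as (r & Or & _ & E); auto.
    { apply card_le_star_ordinal; auto; apply (card_le_star_trans (Y := prod h h)).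
      - apply card_le_star_iff; exists U; split; auto.
        intros y Hy; apply (in_repl _ _ FU) in Hy as (q & Hq & ->); exists q; split; auto.
        apply in_sep in Hq as [Hq K]; auto; revert Hq; apply subset_prod; intros x Hx; auto.
        apply (ord_trans Oh Hch Hx).
      - apply card_le_star_of_le, hessenberg; auto. }
    apply equipotent_le in E as [rU Ur].
    assert (Hr : r ∈ h).
    { apply (in_hartogs Hh Or), (card_le_trans rU), card_le_subset; auto. }
    apply (cardinal_not_le_prod Ch Lh Hch Hr).
    apply card_le_iff in Ur as (V & HV & V1 & V2).
    set (first := fun x => lst (fun i => i ∈ c /\ x ∈ mu i)).
    assert (Ff : Fn first) by dfn.
    assert (Hfirst : forall x, x ∈ h -> first x ∈ c /\ x ∈ mu (first x)).
    { intros x Hx; destruct (mu2 (suc x)) as (i & Hi & L); [apply limit_suc; auto|].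
      apply (@lst_least M _ (fun i => i ∈ c /\ x ∈ mu i) i); [dfn|apply (ord_mem Oc Hi)|].
      split; auto. apply (ord_lt_le_trans (b := suc x)); auto; [apply (ord_mem Oh (mu1 i Hi))|].
      apply in_suc; auto. }
    assert (HU : forall x, x ∈ h -> U (opair (first x) x) ∈ repl D U).
    { intros x Hx; apply (in_repl _ _ FU); eexists; split; [|reflexivity].
      apply HD; apply Hfirst; auto. }
    apply card_le_iff; exists (fun x => opair (first x) (V (U (opair (first x) x)))).
    split; [dfn|split].
    + intros x Hx; apply opair_in_prod; split; [apply Hfirst; auto|apply V1; auto].
    + intros x y Hx Hy E; apply opair_inj in E as [E1 E2]; apply V2 in E2; auto.
      unfold U in E2; rewrite !left_opair, !right_opair in E2.
      destruct (Hfirst x Hx) as [C1 C2], (Hfirst y Hy) as [_ C3].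
      rewrite <- E1 in E2, C3. apply (Hb (first x) C1); auto.
Qed.

Theorem thinly_cofinal_of_gap (X h l c : M) : is_hartogs X h -> is_lindenbaum X l -> h ∈ l ->
  is_cofinality h c -> exists Z R, thinly_cofinal c Z R.
Proof.
  intros Hh Hl hl Hc; assert (Lh := hartogs_limit Hh Hl hl).
  assert (Oh : ordinal h) by apply Hh; assert (Oc : ordinal c) by apply Hc.
  assert (K : exists Z R, thinly_cofinal h Z R).
  { assert (L : ord_le c h).
    { apply (cofinality_min (F := fun x => x) Hc Oh); [dfn|apply Lh|].
      intros x Hx; exists x; auto using ord_le_refl. }
    destruct L as [L|L].
    - apply (thinly_cofinal_singular Hh Lh Hc L).
    - subst c; apply (thinly_cofinal_regular Hh Hl hl Hc). }
  destruct K as (Z & R & K).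
  destruct (thinly_cofinal_cofinality Lh Hc K) as [R' HR']; eauto.
Qed.

(** An element [s] of the seed enumerates a well-orderable part of [Z]; sending [s]
    to the bound of that part covers an unbounded subset of [c]. *)
Theorem thinly_cofinal_seed (S c Z R : M) : SVC S -> limit_ordinal c -> is_cofinality c c ->
  thinly_cofinal c Z R -> card_le_star c S.
Proof.
  intros HS Lc Hc [H1 H2]; assert (Oc : ordinal c) by apply Hc.
  destruct (HS Z) as (n & P & On & HP & H); apply is_product_eq in HP as ->.
  apply card_le_star_iff in H as (F & HF & SF).
  set (A := fun s => sep (repl n (fun b => F (opair s b))) (fun z => z ∈ Z)).
  assert (HA : forall s z, z ∈ A s <-> z ∈ Z /\ exists b, b ∈ n /\ z = F (opair s b)).
  { intros s z; unfold A; rewrite in_sep, in_repl by dfn; tauto. }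
  assert (FA : Fn A) by dfn.
  set (Q := fun s x => x ∈ c /\ forall z j, z ∈ A s -> j ∈ c -> opair z j ∈ R -> ord_le j x).
  assert (HQ : Rel2 Q) by dfn.
  assert (K : forall s, Q s (lst (Q s))).
  { intros s; destruct (H2 (A s)) as (x & Hx & Bx).
    - intros z Hz; apply HA in Hz; tauto.
    - apply (@well_orderable_subset _ (repl n (fun b => F (opair s b)))).
      + intros z Hz; apply in_sep in Hz as []; auto; dfn.
      + apply well_orderable_repl; auto; dfn.
    - apply (@lst_least M _ (Q s) x); [dfn|apply (ord_mem Oc Hx)|split; auto]. }
  assert (FB : Fn (fun s => lst (Q s))) by dfn.
  set (B := repl S (fun s => lst (Q s))).
  assert (Bc : subset B c).
  { intros x Hx; apply (in_repl _ _ FB) in Hx as (s & _ & ->); apply K. }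
  apply (card_le_star_trans (Y := B)).
  - apply (card_le_star_trans (Y := otp B)).
    + apply card_le_star_of_le, card_le_of_ord_le; auto; [apply (ordinal_otp Oc Bc)|].
      destruct (proj1 (card_le_star_iff _ _) (card_le_star_of_le (card_le_otp Oc Bc)))
        as (E & HE & SE).
      apply (cofinality_min Hc (ordinal_otp Oc Bc) HE); [apply Lc|].
      intros x Hx; destruct (H1 x Hx) as (z & j & Hz & Hj & Rz & L).
      destruct (SF z Hz) as (q & Hq & <-); apply in_prod in Hq as (s & b & Hs & Hb & ->).
      destruct (SE (lst (Q s))) as (d & Hd & Ed); [apply (in_repl _ _ FB); eauto|].
      exists d; split; auto; rewrite Ed; destruct (K s) as [K1 K2]; split; auto.
      apply (ord_le_trans (ord_mem Oc K1) L), (K2 (F (opair s b))); auto.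
      apply HA; eauto.
    + apply card_le_star_of_le, (card_otp_le Oc Bc).
  - apply card_le_star_iff; exists (fun s => lst (Q s)); split; auto.
    intros x Hx; apply (in_repl _ _ FB) in Hx as (s & Hs & ->); eauto.
Qed.

(** [X] is [Z] spread over [lam] along a cofinal map [mu] from [c]: above [z] stand the
    ordinals below some [mu i], for [i] up to a point over which [z] lies. An embedded
    copy of [lam] would be confined to a product of two smaller ordinals. A surjection
    onto the successor of [lam] would cut it into [lam] many images of [Z], whose order
    types are at most [lam]. *)
Theorem gap_of_thinly_cofinal (lam c Z R t : M) : cardinal lam -> is_cofinality lam c ->
  limit_ordinal c -> thinly_cofinal c Z R -> is_lindenbaum Z t -> ord_le t lam ->
  exists X s, is_hartogs X lam /\ is_succ_cardinal lam s /\ is_lindenbaum X s.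
Proof.
  intros Cl Hc Lc [H1 H2] Ht Ltl.
  assert (Ol : ordinal lam) by apply Cl; assert (Oc : ordinal c) by apply Hc.
  assert (Ot : ordinal t) by apply Ht.
  assert (Lcl : ord_le c lam).
  { apply Hc; auto; apply cofinal_map_iff; exists (fun x => x); split; [dfn|split; auto].
    intros x Hx; exists x; auto using ord_le_refl. }
  assert (Ll := infinite_cardinal_limit Cl Lc Lcl).
  pose proof Hc as (_ & Hf & _); apply cofinal_map_iff in Hf as (mu & Hmu & mu1 & mu2).
  set (Q := fun q => exists i j, j ∈ c /\ opair (left q) j ∈ R /\ ord_le i j /\ right q ∈ mu i).
  assert (HQ : Rel1 Q) by dfn.
  set (X := sep (prod Z lam) Q).
  assert (HX : forall z b, opair z b ∈ X <-> z ∈ Z /\ b ∈ lam /\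
    exists i j, j ∈ c /\ opair z j ∈ R /\ ord_le i j /\ b ∈ mu i).
  { intros z b; unfold X; rewrite in_sep by auto; unfold Q.
    rewrite left_opair, right_opair, opair_in_prod; tauto. }
  assert (Sub : subset X (prod Z lam)) by (intros q Hq; apply in_sep in Hq as []; auto).
  assert (Fib : forall b, b ∈ lam -> exists z, forall x, x ∈ b -> opair z x ∈ X).
  { intros b Hb; destruct (mu2 b Hb) as (i & Hi & Li).
    destruct (H1 i Hi) as (z & j & Hz & Hj & Rz & L); exists z; intros x Hx; apply HX.
    split; auto; split; [apply (ord_trans Ol Hb Hx)|]. exists i, j.
    split; auto; split; auto; split; auto.
    apply (ord_lt_le_trans (ord_mem Ol (mu1 i Hi)) Hx Li). }
  destruct (succ_cardinal_exists Ol) as [s Hs]; exists X, s; split; [|split; auto].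
  - split; auto; split.
    + (* the first coordinates of an embedded [lam] have size [r] below [lam], and the
         second ones are bounded below [lam] *)
      intros H; apply card_le_iff in H as (F & HF & F1 & F2).
      assert (FA : Fn (fun x => left (F x))) by dfn.
      set (A := repl lam (fun x => left (F x))).
      assert (HA : subset A Z).
      { intros z Hz; apply (in_repl _ _ FA) in Hz as (x & Hx & ->).
        specialize (Sub _ (F1 x Hx)); apply in_prod in Sub as (z & b & Hz & _ & E).
        rewrite E, left_opair; auto. }
      assert (W : well_orderable A) by (apply well_orderable_repl; auto).
      destruct (H2 A HA W) as (i & Hi & Bi).
      destruct (well_orderable_equipotent W) as (r & Or & E); apply equipotent_le in E as [rA Ar].
      assert (Hr : r ∈ lam).
      { apply (ord_lt_le_trans (b := t)); auto; apply (in_lindenbaum Ht Or), card_le_star_of_le.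
        apply (card_le_trans rA), card_le_subset, HA. }
      destruct (below_cofinality (b := suc i) (F := mu) Ol Hc) as (x & Hx & Bx); auto.
      { apply limit_suc; auto. }
      { intros d Hd; apply mu1; apply (ord_le_lt_trans Oc (b := i)); auto. apply in_suc_le, Hd. }
      apply (cardinal_not_le_prod Cl Ll Hr Hx), (card_le_trans (Y := prod A x)).
      * apply card_le_iff; exists F; split; auto; split; auto.
        intros y Hy; assert (K := F1 y Hy).
        assert (LA : left (F y) ∈ A) by (apply (in_repl _ _ FA); eauto).
        pose proof (Sub _ K) as P; apply in_prod in P as (z & b & Hz & Hb & E).
        rewrite E in *; rewrite left_opair in LA; apply opair_in_prod; split; auto.
        apply HX in K as (_ & _ & d & j & Hj & Rz & L & Hbd).
        apply (ord_trans (ord_mem Ol Hx) (x := mu d)); auto.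
        apply Bx, in_suc_le, (ord_le_trans (b := j)); eauto using ord_mem.
      * apply card_le_prod; auto. apply card_le_subset; intros y; auto.
    + intros b Ob N; apply ord_not_lt; auto; intros Hb; apply N.
      destruct (Fib b Hb) as [z Hz]; apply card_le_iff; exists (fun x => opair z x).
      split; [dfn|split; auto]. intros x x' _ _ E; apply opair_inj in E; tauto.
  - assert (Os : ordinal s) by apply Hs; assert (Cs : cardinal s) by apply Hs.
    assert (ls : lam ∈ s) by apply Hs.
    split; auto; split.
    + intros H; apply card_le_star_iff in H as (G & HG & SG).
      set (Y := fun b => sep s (fun y => exists z, opair z b ∈ X /\ G (opair z b) = y)).
      assert (FY : Fn Y) by dfn.
      assert (HY : forall b y, y ∈ Y b <-> y ∈ s /\ exists z, opair z b ∈ X /\ G (opair z b) = y).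
      { intros b y; unfold Y; rewrite in_sep by dfn; tauto. }
      assert (YS : forall b, subset (Y b) s) by (intros b y Hy; apply HY in Hy; tauto).
      assert (Lsl : limit_ordinal s) by (apply (infinite_cardinal_limit Cs Ll); left; auto).
      assert (Fst : Fn (fun y => lst (fun b => b ∈ lam /\ y ∈ Y b))) by dfn.
      apply (cardinal_not_le_prod Cs Lsl ls ls), (card_le_family FY Fst Os Ol).
      * intros y Hy; destruct (SG y Hy) as (q & Hq & E).
        pose proof (Sub _ Hq) as P; apply in_prod in P as (z & b & _ & Hb & ->).
        apply (@lst_least M _ (fun b => b ∈ lam /\ y ∈ Y b) b); [dfn|apply (ord_mem Ol Hb)|].
        split; auto; apply HY; eauto.
      * intros b Hb; split; auto; left; apply (ord_lt_le_trans (b := t)); auto.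
        apply (in_lindenbaum Ht (ordinal_otp Os (YS b))).
        apply (card_le_star_trans (Y := Y b)).
        { apply card_le_star_of_le, (card_otp_le Os (YS b)). }
        { apply card_le_star_iff; exists (fun z => G (opair z b)); split; [dfn|].
          intros y Hy; apply HY in Hy as (_ & z & Hz & E); exists z; split; auto.
          apply HX in Hz; tauto. }
    + intros b Ob N; apply ord_not_lt; auto; intros Hb; apply N.
      apply (card_le_star_trans (Y := lam)).
      * apply card_le_star_of_le, (below_succ_cardinal Cl Hs Hb).
      * apply card_le_star_iff; exists right; split; [dfn|].
        intros x Hx; destruct (Fib (suc x)) as [z Hz]; [apply limit_suc; auto|].
        exists (opair z x); rewrite right_opair; split; auto; apply Hz, in_suc; auto.
Qed.

End Thin.

(** * Surjections onto a cardinal absorb well-ordered factors *)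

Section Absorption.
Context {M : set_structure} {hM : ZF M}.
Variables (S theta tau : M) (E : M -> M -> M -> Prop).
Hypotheses (Ct : cardinal tau) (Lt : limit_ordinal tau) (Htheta : theta ∈ tau).
Hypotheses (HE : Rel3 E) (Etau : forall s i y, E s i y -> y ∈ tau).
Hypothesis Efun : forall s i y y', E s i y -> E s i y' -> y = y'.
Hypothesis N : ~ card_le_star tau S.

Let Ot : ordinal tau := proj1 Ct.
Let Oth : ordinal theta := ord_mem Ot Htheta.

Definition values (P : M -> Prop) (j : M) : M :=
  sep tau (fun y => exists s, s ∈ S /\ P s /\ E s j y).

(** The bound on the order types is uniform in the index [j]: for singular [tau], a
    separate bound for each [j] would not keep the union of the values small. *)
Definition small (P : M -> Prop) : Prop :=
  exists r, r ∈ tau /\ forall j, j ∈ theta -> ord_le (otp (values P j)) r.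

Lemma in_values (P : M -> Prop) (j y : M) : Rel1 P ->
  (y ∈ values P j <-> y ∈ tau /\ exists s, s ∈ S /\ P s /\ E s j y).
Proof. intros HP; unfold values; rewrite in_sep by dfn; tauto. Qed.

Lemma values_subset (P : M -> Prop) (j : M) : Rel1 P -> subset (values P j) tau.
Proof. intros HP y Hy; apply in_values in Hy; tauto. Qed.

Lemma small_mono (P Q : M -> Prop) : Rel1 P -> Rel1 Q -> (forall s, P s -> Q s) ->
  small Q -> small P.
Proof.
  intros HP HQ H (r & Hr & K); exists r; split; auto; intros j Hj.
  apply (ord_le_trans (b := otp (values Q j))); auto; [apply (ord_mem Ot Hr)|].
  apply (otp_mono Ot (values_subset HQ)); intros y Hy.
  apply in_values in Hy as (Hy & s & Hs & Ps & Es); auto; apply in_values; eauto 6.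
Qed.

Lemma not_small (P : M -> Prop) (r : M) : Rel1 P -> ~ small P -> r ∈ tau ->
  exists j, j ∈ theta /\ r ∈ otp (values P j).
Proof.
  intros HP H Hr; apply NNPP; intros K; apply H; exists r; split; auto; intros j Hj.
  apply ord_not_lt; eauto using ord_mem, ordinal_otp, values_subset.
Qed.

(** Otherwise the image would have order type [tau], and the positions in it would map
    [S] onto [tau]. *)
Lemma image_small (G : M -> M -> Prop) : Rel2 G ->
  (forall s y y', G s y -> G s y' -> y = y') ->
  otp (sep tau (fun y => exists s, s ∈ S /\ G s y)) ∈ tau.
Proof.
  intros HG Gf; assert (HP : Rel1 (fun y => exists s, s ∈ S /\ G s y)) by dfn.
  set (B := sep tau (fun y => exists s, s ∈ S /\ G s y)).
  assert (HB : forall y, y ∈ B <-> y ∈ tau /\ exists s, s ∈ S /\ G s y).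
  { intros y; apply (in_sep tau y HP). }
  assert (SB : subset B tau) by (intros y Hy; apply HB in Hy; tauto).
  destruct (otp_le Ot SB) as [K|K]; auto; exfalso; apply N; rewrite <- K.
  apply (card_le_star_trans (Y := B)); [apply card_le_star_of_le, (card_otp_le Ot SB)|].
  apply card_le_star_rel with G; auto.
  - intros y Hy; apply HB in Hy as (_ & s & Hs & Gs); eauto.
  - intros y y' s _ _ _; apply Gf.
Qed.

(** Reading off the value of [s] at an index [j] chosen by the label of [s] is a single
    partial map on [S], and its image would be too long for [image_small]. *)
Lemma labelled_choice (F : M -> M -> Prop) (f : M -> M) : Rel2 F -> Fn f ->
  (forall b b' s, F b s -> F b' s -> b = b') ->
  (forall x, x ∈ tau -> exists b j, j ∈ theta /\ ord_le x (f b) /\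
    ord_le (f b) (otp (values (F b) j))) -> False.
Proof.
  intros HF Hf Ff H.
  set (J := fun b => lst (fun j => j ∈ theta /\ ord_le (f b) (otp (values (F b) j)))).
  assert (HJ : Fn J) by (unfold J, values; dfn).
  set (G := fun s y => exists b, F b s /\ E s (J b) y).
  assert (HG : Rel2 G) by dfn.
  assert (K : otp (sep tau (fun y => exists s, s ∈ S /\ G s y)) ∈ tau).
  { apply image_small; auto. intros s y y' (b & Fb & Eb) (b' & Fb' & Eb').
    rewrite (Ff _ _ _ Fb' Fb) in Eb'; eauto. }
  assert (HP : Rel1 (fun y => exists s, s ∈ S /\ G s y)) by dfn.
  set (B := sep tau (fun y => exists s, s ∈ S /\ G s y)) in *.
  assert (SB : subset B tau) by (intros y Hy; apply in_sep in Hy as []; auto).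
  destruct (H (suc (otp B))) as (b & j & Hj & L1 & L2); [apply limit_suc; auto|].
  assert (HFb : Rel1 (F b)) by dfn.
  assert (KJ : J b ∈ theta /\ ord_le (f b) (otp (values (F b) (J b)))).
  { apply (@lst_least M _ (fun j => j ∈ theta /\ ord_le (f b) (otp (values (F b) j))) j); auto.
    - unfold values; dfn.
    - apply (ord_mem Oth Hj). }
  destruct KJ as [J1 J2]; assert (OB := ord_mem Ot K).
  assert (OV : ordinal (otp (values (F b) (J b)))) by (apply (ordinal_otp Ot), values_subset; auto).
  apply (ord_irrefl OB), (ord_lt_le_trans (b := suc (otp B))); auto; [apply in_suc; auto|].
  apply (ord_le_trans OB (b := otp (values (F b) (J b)))).
  - apply (ord_le_trans OV L1 J2).
  - apply (otp_mono Ot SB); intros y Hy; apply in_values in Hy as (Hy & s & Hs & Fs & Es); auto.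
    apply in_sep; auto; split; auto; exists s; split; auto; exists b; auto.
Qed.

(** If the bounds [n b] of the small parts were unbounded, a part whose bound comes
    right after an earlier bound [x] would have, for some [j], at least [x] values. *)
Lemma small_union (F : M -> M -> Prop) : Rel2 F ->
  (forall b b' s, F b s -> F b' s -> b = b') -> (forall b s, F b s -> b ∈ tau) ->
  (forall b, small (F b)) -> small (fun s => exists b, F b s).
Proof.
  intros HF Ff Ft Fs.
  assert (HFb : forall b, Rel1 (F b)) by (intros; dfn).
  assert (HP : Rel1 (fun b => exists s, s ∈ S /\ F b s)) by dfn.
  set (D := sep tau (fun b => exists s, s ∈ S /\ F b s)).
  assert (HD : forall b, b ∈ D <-> b ∈ tau /\ exists s, s ∈ S /\ F b s).
  { intros b; apply (in_sep tau b HP). }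
  assert (Dt : subset D tau) by (intros b Hb; apply HD in Hb; tauto).
  assert (De : otp D ∈ tau).
  { apply (image_small (G := fun s b => F b s)); [dfn|]. intros s b b'; apply Ff. }
  set (bound := fun b r => forall j, j ∈ theta -> ord_le (otp (values (F b) j)) r).
  assert (HB : Rel2 bound) by (unfold bound, values; dfn).
  set (n := fun b => lst (bound b)).
  assert (Hn : Fn n) by dfn.
  assert (Kn : forall b, n b ∈ tau /\ is_least_ordinal (bound b) (n b)).
  { intros b; destruct (Fs b) as (r & Hr & Br).
    assert (L : is_least_ordinal (bound b) (n b)).
    { apply (@lst_least M _ _ r); [dfn|apply (ord_mem Ot Hr)|auto]. }
    split; auto. apply (ord_le_lt_trans Ot (b := r)); auto. apply L; auto.
    apply (ord_mem Ot Hr). }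
  assert (On : forall b, ordinal (n b)) by (intros b; apply (Kn b)).
  assert (R : exists r, r ∈ tau /\ forall b, b ∈ D -> ord_le (n b) r).
  { apply NNPP; intros K.
    assert (U : forall x, x ∈ tau -> exists b, b ∈ D /\ x ∈ n b).
    { intros x Hx; apply NNPP; intros K'; apply K; exists x; split; auto.
      intros b Hb; apply ord_not_lt; auto; [apply (ord_mem Ot Hx)|eauto]. }
    set (Q := fun b r => forall b', b' ∈ D -> n b' ∈ n b -> ord_le (n b') r).
    assert (HQ : Rel2 Q) by dfn.
    apply (@labelled_choice F (fun b => lst (Q b))); auto; [dfn|].
    intros x Hx; destruct (U x Hx) as (a & Ha & La).
    destruct (U (n a) (proj1 (Kn a))) as (c & Hc & Lc).
    destruct (@ord_least M _ (fun m => n a ∈ m /\ exists b, b ∈ D /\ n b = m) (n c))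
      as (m & Om & (Lm & b & Hb & <-) & Mb); [dfn|auto|eauto|].
    assert (EQ : lst (Q b) = n a).
    { apply lst_eq; [dfn|split; auto; split].
      - intros b' Hb' L; apply ord_not_lt; auto; intros L'.
        apply (ord_irrefl (On b')), (ord_lt_le_trans (b := n b)); auto. apply Mb; eauto.
      - intros r Or Qr; apply Qr; auto. }
    exists b; rewrite EQ; apply NNPP; intros K'.
    apply (ord_irrefl (On a)), (ord_lt_le_trans (b := n b)); auto.
    apply (Kn b); auto; intros j Hj.
    assert (OV : ordinal (otp (values (F b) j))) by (apply (ordinal_otp Ot), values_subset; auto).
    apply ord_not_lt; auto; intros L; apply K'; exists j; split; auto; split; left; auto. }
  destruct R as (r & Hr & Br).
  set (P := fun s => exists b, F b s).
  assert (HPP : Rel1 P) by dfn.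
  set (V := fun q => values (F (left q)) (right q)).
  assert (HV : Fn V) by (unfold V, values; dfn).
  (* the values at all indices are collected first, to get a bound that serves them all *)
  assert (HT : Rel1 (fun y => exists j, j ∈ theta /\ y ∈ values P j)) by (unfold values; dfn).
  set (T := sep tau (fun y => exists j, j ∈ theta /\ y ∈ values P j)).
  assert (Tt : subset T tau) by (intros y Hy; apply in_sep in Hy as []; auto).
  destruct (prod_below_cardinal Ct Lt De Htheta) as (m & Hm & Lm).
  assert (KT : card_le T (prod (prod D theta) r)).
  { set (fb := fun y => lst (fun b => b ∈ D /\ exists j, j ∈ theta /\ y ∈ values (F b) j)).
    assert (Hfb : Fn fb) by (unfold fb, values; dfn).
    set (fj := fun y => lst (fun j => j ∈ theta /\ y ∈ values (F (fb y)) j)).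
    assert (Hfj : Fn fj) by (unfold fj, values; dfn).
    apply (@card_le_family M _ V (fun y => opair (fb y) (fj y)) T (prod D theta) tau r); auto.
    - dfn.
    - apply (ord_mem Ot Hr).
    - intros y Hy; apply in_sep in Hy as (Hy & j & Hj & Hv); auto.
      apply in_values in Hv as (_ & s & Hs & (b & Fb) & Es); auto.
      assert (K : fb y ∈ D /\ exists j, j ∈ theta /\ y ∈ values (F (fb y)) j).
      { apply (@lst_least M _ (fun b => b ∈ D /\ exists j, j ∈ theta /\ y ∈ values (F b) j) b).
        - unfold values; dfn.
        - apply (ord_mem Ot (Ft _ _ Fb)).
        - split; [apply HD; eauto|]. exists j; split; auto; apply in_values; eauto. }
      destruct K as (K1 & j' & Hj' & K2).
      assert (K : fj y ∈ theta /\ y ∈ values (F (fb y)) (fj y)).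
      { apply (@lst_least M _ (fun j => j ∈ theta /\ y ∈ values (F (fb y)) j) j'); auto.
        - unfold values; dfn.
        - apply (ord_mem Oth Hj'). }
      unfold V; rewrite left_opair, right_opair, opair_in_prod; tauto.
    - intros q Hq; apply in_prod in Hq as (b & j & Hb & Hj & ->).
      unfold V; rewrite left_opair, right_opair; split; [apply values_subset; auto|].
      apply (ord_le_trans (b := n b)); auto; [apply (ord_mem Ot Hr)|]. apply (Kn b); auto. }
  assert (OT := ordinal_otp Ot Tt).
  exists (otp T); split.
  - apply ord_lt_of_not_card_le; auto; intros K.
    apply (cardinal_not_le_prod Ct Lt Hm Hr), (card_le_trans K).
    apply (card_le_trans (card_otp_le Ot Tt)), (card_le_trans KT), card_le_prod.
    + refine (card_le_trans _ Lm); apply card_le_prod; [apply (card_le_otp Ot Dt)|].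
      apply card_le_subset; intros x; auto.
    + apply card_le_subset; intros x; auto.
  - intros j Hj; apply (otp_mono Ot Tt); intros y Hy; apply in_sep; auto; split; eauto.
    apply in_values in Hy; tauto.
Qed.

Definition big (i : M) : M := sep tau (fun b => ~ small (fun s => E s i b)).

Lemma Fn_big : Fn big.
Proof. unfold big, small, values; dfn. Qed.

Lemma in_big (i b : M) : b ∈ big i <-> b ∈ tau /\ ~ small (fun s => E s i b).
Proof. unfold big; rewrite in_sep; [tauto|]. unfold small, values; dfn. Qed.

Lemma big_subset (i : M) : subset (big i) tau.
Proof. intros b Hb; apply in_big in Hb; tauto. Qed.

(** For [b] in [big i], the part with value [b] at [i] takes more than [f b] values at
    some index, whatever [f b] is below [tau]; so [labelled_choice] applies. *)
Lemma big_bounded (i : M) (f : M -> M) : Fn f ->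
  (forall x, x ∈ tau -> exists b, b ∈ big i /\ f b ∈ tau /\ ord_le x (f b)) -> False.
Proof.
  intros Hf H'; apply (@labelled_choice (fun b s => E s i b) f); auto.
  - dfn.
  - eauto.
  - intros x Hx; destruct (H' x Hx) as (b & Hb & Fb & L); apply in_big in Hb as [Hb Nb].
    destruct (@not_small (fun s => E s i b) (f b)) as (j & Hj & K); auto; [dfn|].
    exists b, j; split; auto; split; auto; left; auto.
Qed.

(** If the order types of the sets [big i] were unbounded, one [big i0] would be longer
    than [theta], and reading these order types along it would be an unbounded map. *)
Lemma big_uniform : exists r, r ∈ tau /\ forall i, i ∈ theta -> ord_le (otp (big i)) r.
Proof.
  pose proof Fn_big as HB.
  assert (K : forall i, otp (big i) ∈ tau).
  { intros i; destruct (otp_le Ot (@big_subset i)) as [L|L]; auto; exfalso.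
    apply (@big_bounded i (pos (big i))); [dfn|].
    intros x Hx; rewrite <- L in Hx; apply in_otp in Hx as (b & Hb & ->).
    exists b; split; auto; split; auto using ord_le_refl. rewrite <- L; apply pos_in_otp; auto. }
  apply NNPP; intros NB.
  assert (U : forall x, x ∈ tau -> exists i, i ∈ theta /\ x ∈ otp (big i)).
  { intros x Hx; apply NNPP; intros NU; apply NB; exists x; split; auto.
    intros i Hi; apply ord_not_lt; [apply (ord_mem Ot Hx)|apply (ord_mem Ot (K i))|]; eauto. }
  destruct (U theta Htheta) as (i0 & _ & L0).
  apply (@big_bounded i0 (fun b => otp (big (pos (big i0) b)))); [dfn|].
  intros x Hx; destruct (U x Hx) as (i & Hi & L).
  assert (Hi0 : i ∈ otp (big i0)) by (apply (ord_trans (ord_mem Ot (K i0)) L0 Hi)).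
  apply in_otp in Hi0 as (b & Hb & ->); exists b; split; auto; split; auto; left; auto.
Qed.

Definition good (s : M) : Prop := forall i b, i ∈ theta -> E s i b -> b ∈ big i.

Lemma Rel1_good : Rel1 good.
Proof. pose proof Fn_big; dfn. Qed.

Lemma small_good : small good.
Proof.
  pose proof Rel1_good; destruct big_uniform as (r & Hr & K); exists r; split; auto.
  intros j Hj; apply (ord_le_trans (ord_mem Ot Hr) (b := otp (big j))); auto.
  apply (otp_mono Ot (@big_subset j)); intros y Hy.
  apply in_values in Hy as (_ & s & _ & Gs & Es); auto; apply (Gs j y); auto.
Qed.

(** An element that is not good is labelled by the first index [i] at which its
    value [b] is not big, coded together with [b]. *)
Lemma small_not_good : small (fun s => ~ good s).
Proof.
  pose proof Rel1_good; pose proof Fn_big.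
  destruct (proj1 (card_le_iff _ _) (hessenberg Ct Lt)) as (J & HJ & J1 & J2).
  set (F := fun c s => exists i b, i ∈ theta /\ b ∈ tau /\ c = J (opair i b) /\ E s i b /\
    ~ b ∈ big i /\ forall i' b', i' ∈ i -> E s i' b' -> b' ∈ big i').
  assert (HF : Rel2 F) by dfn.
  assert (HT : forall i, i ∈ theta -> i ∈ tau) by (intros i Hi; apply (ord_trans Ot Htheta Hi)).
  apply small_mono with (fun s => exists c, F c s); [dfn|dfn| |].
  { intros s Ns.
    destruct (not_all_ex_not _ _ Ns) as (i & Hi); destruct (not_all_ex_not _ _ Hi) as (b & Hb).
    destruct (@ord_least M _ (fun i => i ∈ theta /\ exists b, E s i b /\ ~ b ∈ big i) i)
      as (m & Om & (Hm & c & Ec & Nc) & Lm).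
    - dfn.
    - apply (ord_mem Oth); tauto.
    - split; [tauto|]. exists b; tauto.
    - exists (J (opair m c)), m, c; split; auto; split; eauto; split; auto; split; auto; split; auto.
      intros i' b' Hi' Eb'; apply NNPP; intros Nb'; apply (ord_irrefl Om).
      assert (Oi' := ord_mem Om Hi').
      apply (ord_le_lt_trans Om (b := i')); auto; apply Lm; eauto using ord_trans. }
  apply small_union; auto.
  - intros c c' s (i & b & Hi & Hb & -> & Eb & Nb & L) (i' & b' & Hi' & Hb' & -> & Eb' & Nb' & L').
    destruct (ord_total (ord_mem Oth Hi) (ord_mem Oth Hi')) as [K|[K|K]].
    + destruct Nb; eauto.
    + subst i'; rewrite (Efun Eb Eb'); auto.
    + destruct Nb'; eauto.
  - intros c s (i & b & Hi & Hb & -> & _); apply J1, opair_in_prod; auto.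
  - intros c; destruct (classic (exists s, F c s)) as [(s & i & b & Hi & Hb & -> & _ & Nb & _)|K].
    + apply small_mono with (fun s => E s i b); [dfn|dfn| |].
      * intros s' (i' & b' & Hi' & Hb' & Ec & Eb' & _).
        apply J2, opair_inj in Ec as [-> ->]; auto; apply opair_in_prod; auto.
      * apply NNPP; intros Ns; apply Nb, in_big; auto.
    + apply small_mono with good; [dfn|auto| |apply small_good].
      intros s Fs; destruct K; eauto.
Qed.

(** [S] is the union of its good and its other elements, labelled by two ordinals. *)
Lemma small_all : small (fun _ => True).
Proof.
  pose proof Rel1_good.
  assert (t0 : empty ∈ tau).
  { apply ord_not_le; auto using ordinal_empty. intros [K|K]; [apply (in_empty _ K)|].
    destruct Lt as (_ & (x & Hx) & _); rewrite K in Hx; apply (in_empty _ Hx). }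
  assert (t1 := limit_suc Lt t0).
  assert (Ne : empty <> suc (empty (M := M))).
  { intros K; apply (in_empty (empty (M := M))); rewrite K at 2; apply in_suc; auto. }
  set (F := fun c s => c = empty /\ good s \/ c = suc empty /\ ~ good s).
  assert (HF : Rel2 F) by dfn.
  apply small_mono with (fun s => exists c, F c s); [dfn|dfn| |].
  { intros s _; destruct (classic (good s)); [exists empty|exists (suc empty)]; unfold F; auto. }
  apply small_union; auto.
  - intros c c' s [[-> ?]|[-> ?]] [[-> ?]|[-> ?]]; tauto.
  - intros c s [[-> _]|[-> _]]; auto.
  - intros c; destruct (classic (c = empty)) as [K|K].
    + apply small_mono with good; [dfn|auto| |apply small_good].
      intros s [[_ ?]|[-> _]]; auto. congruence.
    + apply small_mono with (fun s => ~ good s); [dfn|dfn| |apply small_not_good].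
      intros s [[? _]|[_ ?]]; tauto.
Qed.

Lemma not_covered : ~ forall y, y ∈ tau -> exists s i, s ∈ S /\ i ∈ theta /\ E s i y.
Proof.
  intros H'; destruct small_all as (r & Hr & K).
  assert (HT : Rel1 (fun _ : M => True)) by dfn.
  assert (HV : Fn (values (fun _ => True))) by (unfold values; dfn).
  apply (cardinal_not_le_prod Ct Lt Htheta Hr).
  apply (@card_le_family M _ (values (fun _ => True))
    (fun y => lst (fun j => j ∈ theta /\ y ∈ values (fun _ => True) j)) tau theta tau r); auto.
  - unfold values; dfn.
  - apply (ord_mem Ot Hr).
  - intros y Hy; destruct (H' y Hy) as (s & i & Hs & Hi & Es).
    apply (@lst_least M _ (fun j => j ∈ theta /\ y ∈ values (fun _ => True) j) i).
    + unfold values; dfn.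
    + apply (ord_mem Oth Hi).
    + split; auto; apply in_values; eauto.
  - intros i Hi; split; auto; apply values_subset; auto.
Qed.

End Absorption.

(** For regular [tau] the sizes of the images of [S] at the single indices are
    bounded, and this would suffice; the detour through small parts is for singular
    [tau]. Without a surjection [S] would itself be small: its elements that are not
    good by [small_not_good], the good ones by [small_good]. *)
Theorem card_le_star_absorb {M : set_structure} {hM : ZF M} (S theta tau : M)
    (E : M -> M -> M -> Prop) :
  cardinal tau -> limit_ordinal tau -> theta ∈ tau -> Rel3 E ->
  (forall s i y, E s i y -> y ∈ tau) ->
  (forall s i y y', E s i y -> E s i y' -> y = y') ->
  (forall y, y ∈ tau -> exists s i, s ∈ S /\ i ∈ theta /\ E s i y) ->
  card_le_star tau S.
Proof.
  intros Ct Lt Hth HE Etau Efun H; apply NNPP; intros N.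
  apply (not_covered Ct Lt Hth HE Etau Efun N H).
Qed.

(** * The spectrum of gaps *)

Section Main.
Context {M : set_structure} {hM : ZF M}.

Lemma regular_limit (c : M) : regular_cardinal c -> limit_ordinal c /\ is_cofinality c c.
Proof.
  intros (Cc & (w & Hw & L) & Hc); split; auto.
  apply (infinite_cardinal_limit (a := w)); auto. apply Hw.
Qed.

(** For [t] the larger of [h]'s successor and the Lindenbaum number of [S], a
    surjection from [X] onto [t] covers [t] by sets of order type below [h] indexed by
    [S]; absorbing the factor [h] leaves a surjection from [S] onto [t]. *)
Theorem lindenbaum_le_seed (S X h hplus l s : M) : SVC S -> is_hartogs X h ->
  is_succ_cardinal h hplus -> is_lindenbaum X l -> hplus ∈ l -> is_lindenbaum S s ->
  ord_le l s.
Proof.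
  intros HS Hh Hp Hl Hpl Hs.
  assert (Oh : ordinal h) by apply Hh; assert (Ol : ordinal l) by apply Hl.
  assert (Os : ordinal s) by apply Hs; assert (Op : ordinal hplus) by apply Hp.
  assert (hhp : h ∈ hplus) by apply Hp.
  assert (hl : h ∈ l) by apply (ord_trans Ol Hpl hhp).
  assert (Lh := hartogs_limit Hh Hl hl).
  apply ord_not_lt; auto; intros sl.
  destruct (ord_max Ol Hpl sl) as (t0 & Ht0 & pt0 & st0).
  assert (Ht : exists t, t ∈ l /\ cardinal t /\ ord_le hplus t /\ ord_le s t).
  { destruct (ord_total Op Os) as [K|[K|K]].
    - exists s; split; auto; split; [apply (cardinal_lindenbaum Hs)|split; [left|right]; auto].
    - exists s; split; auto; split; [apply (cardinal_lindenbaum Hs)|split; right; auto].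
    - exists hplus; split; auto; split; [apply Hp|split; [right|left]; auto]. }
  destruct Ht as (t & Ht & Ct & pt & st).
  assert (Ot : ordinal t) by apply Ct.
  assert (ht : h ∈ t) by (apply (ord_lt_le_trans Ot hhp pt)).
  assert (Lt : limit_ordinal t) by (apply (infinite_cardinal_limit Ct Lh); left; auto).
  destruct (HS X) as (n & P & On & HP & HX); apply is_product_eq in HP as ->.
  apply card_le_star_iff in HX as (F & HF & SF).
  destruct (proj1 (card_le_star_iff _ _) (proj1 (in_lindenbaum Hl Ot) Ht)) as (G & HG & SG).
  set (W := fun a => sep t (fun y => exists b, b ∈ n /\ F (opair a b) ∈ X /\ G (F (opair a b)) = y)).
  assert (FW : Fn W) by dfn.
  assert (HW : forall a y, y ∈ W a <->
    y ∈ t /\ exists b, b ∈ n /\ F (opair a b) ∈ X /\ G (F (opair a b)) = y).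
  { intros a y; unfold W; rewrite in_sep by dfn; tauto. }
  assert (Wt : forall a, subset (W a) t) by (intros a y Hy; apply HW in Hy; tauto).
  assert (Wh : forall a, otp (W a) ∈ h).
  { intros a; apply (in_hartogs Hh (ordinal_otp Ot (@Wt a))).
    apply (card_le_trans (card_otp_le Ot (@Wt a))), card_le_iff.
    set (Q := fun y b => b ∈ n /\ F (opair a b) ∈ X /\ G (F (opair a b)) = y).
    assert (HQ : Rel2 Q) by dfn.
    assert (K : forall y, y ∈ W a -> is_least_ordinal (Q y) (lst (Q y))).
    { intros y Hy; apply HW in Hy as (_ & b & Hb & Fb & E).
      apply (@lst_least M _ (Q y) b); [dfn|apply (ord_mem On Hb)|split; auto]. }
    exists (fun y => F (opair a (lst (Q y)))); split; [dfn|split].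
    - intros y Hy; apply (K y Hy).
    - intros y z Hy Hz E; destruct (K y Hy) as (_ & (_ & _ & <-) & _).
      destruct (K z Hz) as (_ & (_ & _ & <-) & _); rewrite E; auto. }
  apply (ord_irrefl Os), (in_lindenbaum Hs Os).
  apply (card_le_star_trans (Y := t)).
  { apply card_le_star_of_le, card_le_of_ord_le; auto. }
  apply (@card_le_star_absorb M _ S h t (fun a i y => y ∈ W a /\ pos (W a) y = i)); auto.
  - dfn.
  - intros a i y [Hy _]; apply (Wt a y Hy).
  - intros a i y y' [Hy E] [Hy' E']; apply (pos_inj Ot (@Wt a)); congruence.
  - intros y Hy; destruct (SG y Hy) as (x & Hx & E), (SF x Hx) as (q & Hq & E').
    apply in_prod in Hq as (a & b & Ha & Hb & ->).
    assert (K : y ∈ W a).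
    { apply HW; split; auto; exists b; rewrite E'; auto. }
    exists a, (pos (W a) y); split; auto; split; auto.
    apply (ord_trans Oh (Wh a)), pos_in_otp, K.
Qed.

(** Taking, for each [c], the least Lindenbaum number of a set thin over [c] avoids
    choosing such a set, and replacement gives a common bound. *)
Lemma thin_bound (C : M) : exists Omega, cardinal Omega /\
  forall c, c ∈ C -> (exists Z R, thinly_cofinal c Z R) ->
  exists Z R t, thinly_cofinal c Z R /\ is_lindenbaum Z t /\ ord_le t Omega.
Proof.
  set (Q := fun c t => exists Z R, thinly_cofinal c Z R /\ is_lindenbaum Z t).
  assert (HQ : Rel2 Q) by dfn.
  assert (HF : Fn (fun c => lst (Q c))) by dfn.
  assert (OA : forall t, t ∈ repl C (fun c => lst (Q c)) -> ordinal t).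
  { intros t Ht; apply (in_repl _ _ HF) in Ht as (c & _ & ->); apply ordinal_lst; dfn. }
  assert (Ob := ordinal_bigcup OA).
  destruct (succ_cardinal_exists Ob) as (Om & (OOm & [COm Hb] & _)); exists Om; split; auto.
  intros c Hc (Z & R & K); destruct (lindenbaum_exists Z) as [t Ht].
  destruct (@lst_least M _ (Q c) t) as (_ & (Z' & R' & K' & Ht') & _).
  - dfn.
  - apply Ht.
  - exists Z, R; auto.
  - exists Z', R', (lst (Q c)); split; auto; split; auto; left.
    apply (ord_le_lt_trans OOm (b := bigcup (repl C (fun c => lst (Q c))))); auto.
    apply bigcup_upper; auto. apply (in_repl _ _ HF); eauto.
Qed.

End Main.

Theorem theorem5p13 (M : set_structure) (hM : ZF M) (S : M) (hS : SVC S) :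
  exists C Omega : M,
    (forall k : M, k ∈ C ->
       regular_cardinal k /\ exists s : M, is_lindenbaum S s /\ k ∈ s) /\
    cardinal Omega /\
    (forall X h l : M,
       is_hartogs X h -> is_lindenbaum X l -> h ∈ l ->
       exists c : M, is_cofinality h c /\ c ∈ C) /\
    (forall X h hplus l : M,
       is_hartogs X h -> is_succ_cardinal h hplus -> is_lindenbaum X l ->
       hplus ∈ l ->
       exists s : M, is_lindenbaum S s /\ ord_le l s) /\
    (forall lambda c : M,
       cardinal lambda -> ord_le Omega lambda ->
       is_cofinality lambda c -> c ∈ C ->
       exists X lambdaplus : M,
         is_hartogs X lambda /\
         is_succ_cardinal lambda lambdaplus /\
         is_lindenbaum X lambdaplus).
Proof.
  destruct (lindenbaum_exists S) as [s Hs].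
  assert (HC : Rel1 (fun k : M => regular_cardinal k /\ exists Z R, thinly_cofinal k Z R))
    by dfn.
  set (C := sep s (fun k => regular_cardinal k /\ exists Z R, thinly_cofinal k Z R)).
  assert (InC : forall k, k ∈ C <-> k ∈ s /\ regular_cardinal k /\
    exists Z R, thinly_cofinal k Z R) by (intros k; apply (in_sep s k HC)).
  destruct (thin_bound C) as (Omega & COm & HOm); exists C, Omega.
  split; [|split; [auto|split; [|split]]].
  - intros k Hk; apply InC in Hk as (Hk & Rk & _); eauto.
  - intros X h l Hh Hl hl; assert (Oh : ordinal h) by apply Hh.
    destruct (cofinality_exists Oh) as [c Hc]; exists c; split; auto.
    assert (Rc := cofinality_regular (hartogs_limit Hh Hl hl) Hc).
    destruct (regular_limit Rc) as [Lc Hcc].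
    destruct (thinly_cofinal_of_gap Hh Hl hl Hc) as (Z & R & K).
    apply InC; split; [|eauto].
    apply (in_lindenbaum Hs); [apply Lc|]. apply (thinly_cofinal_seed hS Lc Hcc K).
  - intros X h hplus l Hh Hp Hl Hpl; exists s; split; auto.
    apply (lindenbaum_le_seed hS Hh Hp Hl Hpl Hs).
  - intros lam c Cl Ll Hc HcC; destruct (proj1 (InC c) HcC) as (_ & Rc & K).
    destruct (regular_limit Rc) as [Lc _].
    destruct (HOm c HcC K) as (Z & R & t & HZ & Ht & Lt).
    apply (gap_of_thinly_cofinal Cl Hc Lc HZ Ht).
    apply (ord_le_trans (proj1 Cl) Lt Ll).
Qed.
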